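(* Let $\mathsf{M}\in\mathbb{C}^{D\times D}$ and let $\{\mathsf{M}_{\mu\nu}\}_{1\le\mu,\nu\le n}$ be an arbitrary partition of $\mathsf{M}$, with $\mathcal{G}$ the corresponding graph and $\mathcal{G}_0$ the graph $\mathcal{G}$ with all self-loops deleted. Then for $\tau\in\mathbb{C}$ and all $\alpha,\omega$ the partition of $\exp(\tau\mathsf{M})$ is given by $$\exp(\tau\mathsf{M})_{\omega\alpha} = \mathfrak{L}^{-1}\left\{\sum_{P_{\mathcal{G}_0;\alpha\omega}} \mathsf{F}_{\mathcal{G}\backslash\{\alpha,\nu_2,\ldots,\nu_\ell\}}[\omega]\,\mathsf{M}_{\omega\nu_\ell}\cdots \mathsf{F}_{\mathcal{G}\backslash\{\alpha\}}[\nu_2]\,\mathsf{M}_{\nu_2\alpha}\, \mathsf{F}_\mathcal{G}[\alpha]\right\}(t)\Bigg|_{t=\tau},$$ where the sum runs over all paths $(\alpha,\nu_2,\ldots,\nu_\ell,\omega)$ from $\alpha$ to $\omega$ on $\mathcal{G}_0$, $\ell$ is the length of the path, and $\mathsf{F}$ is defined recursively (for $\mathcal{G}$ and, in the same way, for each graph obtained from it by deleting vertices) by $$\mathsf{F}_{\mathcal{G}}[\alpha] = \left[s\mathsf{I}-\mathsf{M}_{\alpha} - \sum_{C_{\mathcal{G}_0;\alpha}}\mathsf{M}_{\alpha\mu_m}\, \mathsf{F}_{\mathcal{G}\backslash\{\alpha,\mu_2,\ldots,\mu_{m-1}\}}[\mu_m]\cdots \mathsf{F}_{\mathcal{G}\backslash\{\alpha\}}[\mu_2]\,\mathsf{M}_{\mu_2\alpha}\right]^{-1},$$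 where the sum runs over all bare cycles $(\alpha,\mu_2,\ldots,\mu_m,\alpha)$ off $\alpha$ on $\mathcal{G}_0$ and $m$ is the length of the bare cycle.
   Context: Partition of a matrix: let $V=V_1\oplus\cdots\oplus V_n=\mathbb{C}^D$, where each $V_\mu$ (of dimension $d_\mu\geq 1$) is spanned by a subset of the standard orthonormal basis vectors, these subsets being disjoint. Let $\mathsf{R}_\mu\in\mathbb{C}^{d_\mu\times D}$ be the restriction to these coordinates, so $\mathsf{R}_\mu^{\mathrm T}\mathsf{R}_\mu=\varepsilon_\mu$ is the orthogonal projector onto $V_\mu$. The corresponding partition of a $D\times D$ matrix $\mathsf{A}$ is the family $\mathsf{A}_{\mu\nu}=\mathsf{R}_\mu\mathsf{A}\mathsf{R}_\nu^{\mathrm T}$ (of size $d_\mu\times d_\nu$), $1\le\mu,\nu\le n$; equivalently, up to a permutation of the coordinates, a block decomposition of $\mathsf{A}$. One writes $\mathsf{A}_\mu=\mathsf{A}_{\mu\mu}$. The partition of a matrix function $f(\mathsf{M})$ is taken with the same projectors. $\mathsf{I}$ is the identity matrix of the appropriate size. Graph of a partition $\{\mathsf{A}_{\mu\nu}\}$: the directed graph with vertices labelled $1,\ldots,n$ and with a directed edge from $\nu$ to $\mu$, written $(\nu\mu)$, whenever $\mathsf{A}_{\mu\nu}\neq 0$ (self-loops included). $\mathcal{G}\backslash\{\alpha,\beta,\ldots\}$ is $\mathcal{G}$ with the vertices $\alpha,\beta,\ldots$ deleted; a subscript $0$ means that all self-loops are deleted. Path: a walk whose vertices are all distinct; its length is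 its number of edges. $P_{\mathcal{G};\alpha\omega}$ is the set of paths from $\alpha$ to $\omega$; if $\omega=\alpha$ it consists only of the length-zero path, which contributes $\mathsf{F}_{\mathcal{G}}[\alpha]$. Bare cycle off $\alpha$: a closed walk of positive length from $\alpha$ to $\alpha$ that does not revisit any internal vertex and visits $\alpha$ only at its ends; $C_{\mathcal{G};\alpha}$ is the set of these. An empty sum is zero, so if $\alpha$ has no neighbours in the graph, $\mathsf{F}[\alpha]=[s\mathsf{I}-\mathsf{M}_\alpha]^{-1}$. $s$ is the Laplace variable conjugate to $t$, and the quantities $\mathsf{F}$ are matrices of rational functions of $s$. $\mathfrak{L}^{-1}\{g(s)\}(t)$ is the inverse Laplace transform of $g$; for the rational functions at hand it is an exponential polynomial in $t$, hence an entire function, which is evaluated at $t=\tau\in\mathbb{C}$. *)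

(* Defs.v *)
From HB Require Import structures.
From mathcomp Require Import all_boot all_order all_algebra.
From mathcomp Require Import fraction complex.
From mathcomp Require Import all_classical all_reals all_analysis.

Set Implicit Arguments.
Unset Strict Implicit.
Unset Printing Implicit Defensive.

Import Order.TTheory GRing.Theory Num.Theory.
Import numFieldNormedType.Exports.

Local Open Scope classical_set_scope.
Local Open Scope ring_scope.
Local Open Scope complex_scope.

Section MatrixExponential.
Variable R : realType.
Local Notation C := R[i].

(* Entrywise limit of the exponential series; the regular algebra C^o carries
   the topology given by the modulus. *)
Definition expmx (D : nat) (A : 'M[C]_D) : 'M[C]_D :=
  \matrix_(i, j)
    limn (fun N => (\sum_(k < N) (k`!%:R)^-1 *: A ^+ k) i j : C^o).

Definition expC (z : C) : C :=
  (expR (complex.Re z))%:C * (cos (complex.Im z) +i* sin (complex.Im z)).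

End MatrixExponential.

Section InverseLaplace.
Variable R : realType.
Local Notation C := R[i].
Local Notation ratfun := {fraction {poly C}}.

(* Value at s of the fraction representing g; it does not depend on the
   representative wherever the denominator does not vanish, that is, outside
   of a finite set of s. *)
Definition ratfun_eval (g : ratfun) (s : C) : C :=
  (repr g).1.[s] / (repr g).2.[s].

Definition laplace_integrand (f : C -> C) (s : C) (t : R) : C :=
  expC (- (s * t%:C)) * f t%:C.

Definition laplace_integrable (f : C -> C) (s : C) : Prop :=
  (@lebesgue_measure R).-integrable `[0, +oo[
     (EFin \o (fun t => complex.Re (laplace_integrand f s t))) /\
  (@lebesgue_measure R).-integrable `[0, +oo[
     (EFin \o (fun t => complex.Im (laplace_integrand f s t))).

Definition laplace (f : C -> C) (s : C) : C :=
  (\int[@lebesgue_measure R]_(t in `[0, +oo[)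
      complex.Re (laplace_integrand f s t)) +i*
  (\int[@lebesgue_measure R]_(t in `[0, +oo[)
      complex.Im (laplace_integrand f s t)).

Definition exp_polynomial (f : C -> C) : Prop :=
  exists r : seq ({poly C} * C),
    forall t, f t = \sum_(u <- r) u.1.[t] * expC (u.2 * t).

(* The Laplace integral only involves f on [0, +oo[; requiring f to be an
   exponential polynomial selects its entire extension to C. *)
Definition is_inv_laplace (g : ratfun) (f : C -> C) : Prop :=
  exp_polynomial f /\
  exists sigma : R, forall s : C, sigma < complex.Re s ->
    laplace_integrable f s /\ laplace f s = ratfun_eval g s.

Definition inv_laplace (g : ratfun) : C -> C :=
  xget (fun=> 0) [set f | is_inv_laplace g f].

End InverseLaplace.

Section Partition.
Variables (D n : nat).

(* V mu is the set of the coordinates whose basis vectors span V_mu. *)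
Definition is_partition (V : 'I_n -> {set 'I_D}) : Prop :=
  [/\ forall mu, V mu != finset.set0,
      forall mu nu : 'I_n, mu != nu ->
        (V mu :&: V nu)%SET = finset.set0
    & (\bigcup_mu V mu)%SET = [set: 'I_D]%SET].

Variables (A : pzSemiRingType) (V : 'I_n -> {set 'I_D}).

Definition restr (mu : 'I_n) : 'M[A]_(#|V mu|, D) :=
  \matrix_(k, j) (enum_val k == j)%:R.

Definition block (M : 'M[A]_D) (mu nu : 'I_n) : 'M[A]_(#|V mu|, #|V nu|) :=
  restr mu *m M *m (restr nu)^T.

End Partition.

Section PathSums.
Variables (R : realType) (D n : nat) (V : 'I_n -> {set 'I_D}).
Variable M : 'M[R[i]]_D.
Local Notation ratfun := {fraction {poly R[i]}}.

(* A graph obtained from G by deleting vertices is given by the set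
   S of the remaining vertices. *)
Implicit Types (S : {set 'I_n}) (alpha omega mu nu : 'I_n) (p c : seq 'I_n).

Definition edge : rel 'I_n := [rel nu mu | block V M mu nu != 0].

Definition edge0 : rel 'I_n := [rel nu mu | (nu != mu) && edge nu mu].

(* p lists the vertices after alpha. *)
Definition is_path S alpha omega p : bool :=
  [&& path edge0 alpha p, uniq (alpha :: p), last alpha p == omega
    & all (fun v => v \in S) (alpha :: p)].

(* c lists the internal vertices. *)
Definition is_bare_cycle S alpha c : bool :=
  ucycleb edge0 (alpha :: c) && all (fun v => v \in S) (alpha :: c).

Definition ratcst (z : R[i]) : ratfun := tofrac z%:P.

Definition blockF mu nu : 'M[ratfun]_(#|V mu|, #|V nu|) :=
  map_mx ratcst (block V M mu nu).

Local Notation weights := ({set 'I_n} -> forall mu, 'M[ratfun]_#|V mu|).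

Fixpoint path_weight (F : weights) S alpha p :
    'M[ratfun]_(#|V (last alpha p)|, #|V alpha|) :=
  match p with
  | [::] => F S alpha
  | nu :: p' =>
      path_weight F (S :\ alpha)%SET nu p' *m blockF nu alpha *m F S alpha
  end.

Definition cycle_weight (F : weights) S alpha c : 'M[ratfun]_#|V alpha| :=
  match c with
  | [::] => blockF alpha alpha
  | mu :: c' =>
      blockF alpha (last mu c') *m path_weight F (S :\ alpha)%SET mu c'
        *m blockF mu alpha
  end.

(* The vertices of a path or bare cycle are pairwise distinct, hence at most
   n in number: this bounds the sums below.  In path_sum, conform_mx is a mere
   cast, since last alpha p = omega on each term. *)
Definition cycle_sum (F : weights) S alpha : 'M[ratfun]_#|V alpha| :=
  \sum_(k < n) \sum_(c : k.-tuple 'I_n | is_bare_cycle S alpha c)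
    cycle_weight F S alpha c.

Definition path_sum (F : weights) S alpha omega :
    'M[ratfun]_(#|V omega|, #|V alpha|) :=
  \sum_(l < n) \sum_(p : l.-tuple 'I_n | is_path S alpha omega p)
    conform_mx 0 (path_weight F S alpha p).

Definition Finv (F : weights) S alpha : 'M[ratfun]_#|V alpha| :=
  (tofrac 'X)%:M - blockF alpha alpha - cycle_sum F S alpha.

(* The argument k only ensures termination: FmxE is the recursion that defines
   F on every graph obtained from G, in terms of F itself. *)
Fixpoint Frec (k : nat) : weights :=
  if k is k'.+1 then fun S alpha => invmx (Finv (Frec k') S alpha)
  else fun _ _ => 0.

Definition Fmx : weights := fun S alpha => Frec #|S| S alpha.

Lemma eq_path_weight (F F' : weights) S alpha p :
    all (fun v => v \in S) (alpha :: p) -> uniq (alpha :: p) ->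
    (forall (T : {set 'I_n}) (beta : 'I_n), T \subset S -> beta \in T ->
       F T beta = F' T beta) ->
  path_weight F S alpha p = path_weight F' S alpha p.
Proof.
elim: p S alpha => [|nu p IHp] S alpha.
  by move=> /= /andP[aS _] _; apply.
rewrite cons_uniq => /andP[aS pS] /andP[anp up] eqF.
rewrite [LHS]/= [RHS]/= (eqF S alpha) //.
rewrite (IHp _ nu) // => [|T beta TS bT]; last first.
  by apply: eqF => //; apply: (fintype.subset_trans TS); rewrite subD1set.
apply/allP => v vp.
rewrite in_setD1 (allP (pS : all (fun w => w \in S) (nu :: p)) v vp) andbT.
by apply: contraNneq anp => <-.
Qed.

Lemma eq_cycle_sum (F F' : weights) S alpha :
    (forall (T : {set 'I_n}) (beta : 'I_n),
       T \subset (S :\ alpha)%SET -> beta \in T ->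
       F T beta = F' T beta) ->
  cycle_sum F S alpha = cycle_sum F' S alpha.
Proof.
move=> eqF; apply: eq_bigr => k _; apply: eq_bigr => -[c cP] /=.
case: c cP => [|mu c] cP // /andP[/andP[_]].
rewrite cons_uniq => /andP[anc uc] /andP[_ cS]; rewrite [LHS]/= [RHS]/=.
rewrite (@eq_path_weight F F') //; apply/allP => v vc.
rewrite in_setD1 (allP (cS : all (fun w => w \in S) (mu :: c)) v vc) andbT.
by apply: contraNneq anc => <-.
Qed.

Lemma FrecE k S alpha : alpha \in S -> (#|S| <= k)%N ->
  Frec k S alpha = Fmx S alpha.
Proof.
rewrite /Fmx; move: {2}#|S| (leqnn #|S|) => m.
elim: m k S alpha => [|m IHm] k S alpha leSm aS leSk.
  by move: aS; move: leSm; rewrite leqn0 cards_eq0 => /eqP->; rewrite inE.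
have cS : #|S| = #|(S :\ alpha)%SET|.+1 by rewrite (cardsD1 alpha) aS.
case: k leSk => [|k] leSk; first by rewrite cS in leSk.
rewrite cS /= /Finv; congr (invmx (_ - _)); apply: eq_cycle_sum.
move=> T beta TS bT; have leT := subset_leq_card TS.
rewrite cS !ltnS in leSk leSm.
by rewrite !IHm // ?(leq_trans leT).
Qed.

Lemma FmxE S alpha : alpha \in S -> Fmx S alpha = invmx (Finv Fmx S alpha).
Proof.
move=> aS; rewrite {1}/Fmx (cardsD1 alpha) aS /= /Finv.
congr (invmx (_ - _)); apply: eq_cycle_sum => T beta TS bT.
by apply: FrecE => //; apply: subset_leq_card.
Qed.

End PathSums.

(* Main.v *)
Require Import Defs.
From HB Require Import structures.
From mathcomp Require Import all_boot all_order all_algebra.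
From mathcomp Require Import fraction complex.
From mathcomp Require Import all_classical all_reals all_analysis.
From mathcomp Require Import measurable_realfun ring lra.

(* Work over the field of rational functions, with the resolvent (s - M)^-1.
   For a set S of vertices let M_S be M with the rows and columns outside of S
   replaced by 0, and G_S = (s - M_S)^-1.  Deleting alpha from S, the resolvent
   identity G_S = G_S' + G_S' (M_S - M_S') G_S expresses the blocks of G_S in
   terms of G_S', M and the diagonal block of G_S at alpha, and this diagonal
   block is the inverse of a Schur complement.  By induction on S the path sums
   are the blocks of G_S and F_S[alpha] is its diagonal block at alpha, so the
   sum over paths from alpha to omega is the block of (s - M)^-1.

   It remains to see that the entries of (s - M)^-1 are the Laplace transforms
   of those of exp(t M).  A strictly proper fraction g is related to an
   exponential polynomial f by two facts that are checked on the partial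
   fractions (s - lambda)^-(j+1) and extended by linearity: g is the Laplace
   transform of f, and if sum_k a_k s^-(k+1) is the expansion of g at infinity,
   then f(t) = sum_k a_k t^k / k!.  The expansion of (s - M)^-1 has the
   coefficients M^k, which gives exp(t M); and g determines a, hence f, so the
   inverse Laplace transform is unique. *)

Set Implicit Arguments.
Unset Strict Implicit.
Unset Printing Implicit Defensive.

Import Order.TTheory GRing.Theory Num.Theory.
Import numFieldNormedType.Exports.

Local Open Scope classical_set_scope.
Local Open Scope ring_scope.
Local Open Scope complex_scope.

(** * Partitions and resolvents *)

Lemma big_tuple_cons (Z : nmodType) (I : finType) (l : nat) (P : pred (seq I))
    (f : seq I -> Z) :
  \sum_(p : l.+1.-tuple I | P p) f p
    = \sum_x \sum_(p : l.-tuple I | P (x :: p)) f (x :: p).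
Proof.
rewrite pair_big_dep /=.
rewrite (reindex (fun u : I * l.-tuple I => cons_tuple u.1 u.2)) /=; last first.
  exists (fun p : l.+1.-tuple I => (thead p, [tuple of behead p])).
    by move=> [x p] _ /=; congr pair; apply: val_inj.
  by move=> p _; rewrite [RHS]tuple_eta; apply: val_inj.
by apply: eq_bigl => -[x p].
Qed.

Section Restriction.
Variables (D n : nat) (V : 'I_n -> {set 'I_D}).
Hypothesis hV : is_partition V.

Lemma mem_part_inj i (mu nu : 'I_n) : i \in V mu -> i \in V nu -> mu = nu.
Proof.
case: hV => _ dis _ imu inu; apply/eqP; apply: contraT => ne.
by move: (dis _ _ ne) => /setP/(_ i); rewrite !inE imu inu.
Qed.

Lemma mem_part_ex i : exists mu : 'I_n, i \in V mu.
Proof.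
case: hV => _ _ /setP/(_ i); rewrite inE => /bigcupP[mu _ imu].
by exists mu.
Qed.

Variable A : comNzRingType.
Local Notation r := (restr A V).

Lemma restr_mul_tr mu nu :
  r mu *m (r nu)^T = \matrix_(k, l) (enum_val k == enum_val l)%:R.
Proof.
apply/matrixP => k l; rewrite !mxE (bigD1 (enum_val k)) //= !mxE eqxx mul1r.
rewrite big1 ?addr0 1?eq_sym // => j ne.
by rewrite !mxE eq_sym (negbTE ne) mul0r.
Qed.

Lemma restrK mu : r mu *m (r mu)^T = 1%:M.
Proof.
rewrite restr_mul_tr; apply/matrixP => k l; rewrite !mxE.
by rewrite (inj_eq enum_val_inj).
Qed.

Lemma restr_orth mu nu : mu != nu -> r mu *m (r nu)^T = 0.
Proof.
move=> ne; rewrite restr_mul_tr; apply/matrixP => k l; rewrite !mxE.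
case: eqP => // e; case/eqP: ne; apply: (mem_part_inj (enum_valP k)).
by rewrite e enum_valP.
Qed.

Definition proj mu : 'M[A]_D := (r mu)^T *m r mu.

Lemma projE mu i j : proj mu i j = ((i \in V mu) && (i == j))%:R.
Proof.
rewrite !mxE; case: (boolP (i \in V mu)) => iV /=.
  rewrite (bigD1 (enum_rank_in iV i)) //= !mxE enum_rankK_in // eqxx mul1r.
  rewrite big1 ?addr0 // => k ne; rewrite !mxE.
  case: eqP => e; last by rewrite mul0r.
  by case/eqP: ne; apply: enum_val_inj; rewrite enum_rankK_in.
rewrite big1 // => k _; rewrite !mxE; case: eqP => e; last by rewrite mul0r.
by rewrite -e enum_valP in iV.
Qed.

Lemma sum_proj : \sum_mu proj mu = 1%:M.
Proof.
apply/matrixP => i j; rewrite summxE !mxE.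
have [mu imu] := mem_part_ex i.
rewrite (bigD1 mu) //= projE imu /= big1 ?addr0 // => nu ne.
rewrite projE; case: (boolP (i \in V nu)) => //= inu.
by rewrite (mem_part_inj imu inu) eqxx in ne.
Qed.

Lemma restr_proj mu : r mu *m proj mu = r mu.
Proof. by rewrite mulmxA restrK mul1mx. Qed.

Lemma proj_idem mu : proj mu *m proj mu = proj mu.
Proof. by rewrite {1}/proj -mulmxA restr_proj. Qed.

Lemma proj_orth mu nu : mu != nu -> proj mu *m proj nu = 0.
Proof.
by move=> ne; rewrite mulmxA -(mulmxA (r mu)^T) restr_orth // mulmx0 mul0mx.
Qed.

Definition projS (S : {set 'I_n}) : 'M[A]_D := \sum_(mu in S) proj mu.

Lemma projST : projS [set: 'I_n]%SET = 1%:M.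
Proof. by rewrite -sum_proj; apply: eq_bigl => mu; rewrite inE. Qed.

Lemma projSD1 (S : {set 'I_n}) alpha :
  alpha \in S -> projS S = proj alpha + projS (S :\ alpha)%SET.
Proof. by move=> aS; rewrite /projS (big_setD1 alpha). Qed.

Lemma proj_projS (S : {set 'I_n}) mu :
  proj mu *m projS S = if mu \in S then proj mu else 0.
Proof.
rewrite mulmx_sumr; case: (boolP (mu \in S)) => muS.
  rewrite (bigD1 mu) //= proj_idem big1 ?addr0 // => nu /andP[_ ne].
  by rewrite proj_orth // eq_sym.
by rewrite big1 // => nu nuS; rewrite proj_orth //; apply: contraNneq muS => ->.
Qed.

Lemma projS_proj (S : {set 'I_n}) mu :
  projS S *m proj mu = if mu \in S then proj mu else 0.
Proof.
rewrite mulmx_suml; case: (boolP (mu \in S)) => muS.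
  rewrite (bigD1 mu) //= proj_idem big1 ?addr0 // => nu /andP[_ ne].
  by rewrite proj_orth.
by rewrite big1 // => nu nuS; rewrite proj_orth //; apply: contraNneq muS => <-.
Qed.

Lemma eq_projS_mul (S : {set 'I_n}) m (B1 B2 : 'M[A]_(D, m)) :
  (forall mu, mu \in S -> proj mu *m B1 = proj mu *m B2) ->
  projS S *m B1 = projS S *m B2.
Proof. by move=> eqB; rewrite !mulmx_suml; apply: eq_bigr. Qed.

End Restriction.

Lemma map_restr (D n : nat) (V : 'I_n -> {set 'I_D}) (A B : comNzRingType)
    (f : {rmorphism A -> B}) mu : map_mx f (restr A V mu) = restr B V mu.
Proof. by apply/matrixP => k j; rewrite !mxE rmorph_nat. Qed.

Lemma map_proj (D n : nat) (V : 'I_n -> {set 'I_D}) (A B : comNzRingType)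
    (f : {rmorphism A -> B}) mu : map_mx f (proj V A mu) = proj V B mu.
Proof. by rewrite map_mxM -map_trmx !map_restr. Qed.

Lemma map_projS (D n : nat) (V : 'I_n -> {set 'I_D}) (A B : comNzRingType)
    (f : {rmorphism A -> B}) S : map_mx f (projS V A S) = projS V B S.
Proof. by rewrite /projS map_mx_sum; apply: eq_bigr => mu _; rewrite map_proj. Qed.

(** * Resolvents over the field of rational functions *)

Section Resolvent.
Variables (R : realType) (D : nat).
Local Notation C := R[i].
Local Notation ratfun := {fraction {poly C}}.

Lemma ratcst_zmod_morphism : zmod_morphism (@ratcst R).
Proof. by move=> x y; rewrite /ratcst !rmorphB. Qed.
HB.instance Definition _ :=
  GRing.isZmodMorphism.Build C ratfun (@ratcst R) ratcst_zmod_morphism.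

Lemma ratcst_monoid_morphism : monoid_morphism (@ratcst R).
Proof. by split=> [|x y]; rewrite /ratcst ?rmorph1 ?rmorphM. Qed.
HB.instance Definition _ :=
  GRing.isMonoidMorphism.Build C ratfun (@ratcst R) ratcst_monoid_morphism.

Local Notation X := (tofrac 'X : ratfun).

(** Locked so that the inverse is never unfolded by accident: it is only used through [mulVres] and
    [mulresV]. *)
Definition resolvent (A : 'M[C]_D) : 'M[ratfun]_D :=
  locked (invmx (X%:M - map_mx (@ratcst R) A)).

(** The determinant is the image of the characteristic polynomial, which is monic and hence a
    nonzero fraction. *)
Lemma resolvent_unit (A : 'M[C]_D) : X%:M - map_mx (@ratcst R) A \in unitmx.
Proof.
have -> : X%:M - map_mx (@ratcst R) A = map_mx (@tofrac _) (char_poly_mx A).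
  by rewrite map_mxB map_scalar_mx -map_mx_comp.
by rewrite unitmxE det_map_mx unitfE tofrac_eq0 monic_neq0 ?char_poly_monic.
Qed.

Lemma mulVres A : resolvent A *m (X%:M - map_mx (@ratcst R) A) = 1%:M.
Proof. by rewrite /resolvent -lock; exact: mulVmx (resolvent_unit A). Qed.

Lemma mulresV A : (X%:M - map_mx (@ratcst R) A) *m resolvent A = 1%:M.
Proof. by rewrite /resolvent -lock; exact: mulmxV (resolvent_unit A). Qed.

Lemma resolvent_identity A B :
  resolvent A = resolvent B
     + resolvent B *m (map_mx (@ratcst R) A - map_mx (@ratcst R) B)
         *m resolvent A.
Proof.
move: (mulVres B) (mulresV A).
move: (map_mx _ A) (map_mx _ B) (resolvent A) (resolvent B) => a b ra rb hb ha.
have -> : a - b = (X%:M - b) - (X%:M - a) by rewrite opprB [RHS]addrC addrA subrK.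
by rewrite mulmxBr hb mulmxBl mul1mx -mulmxA ha mulmx1 addrCA subrr addr0.
Qed.

(** On the kernel of [A] the matrix X - A acts as the scalar X. This handles the coordinates outside
    of S, which M_S sends to 0. *)
Lemma resolvent_mul_eq0 (A : 'M[C]_D) m (E : 'M[ratfun]_(D, m)) :
  map_mx (@ratcst R) A *m E = 0 -> resolvent A *m E = X^-1 *: E.
Proof.
move=> AE; have Xn0 : X != 0 by rewrite tofrac_eq0 polyX_eq0.
rewrite -[E in LHS]scale1r -(mulVf Xn0) -scalerA -scalemxAr; congr (_ *: _).
rewrite -[RHS]mul1mx -(mulVres A) -mulmxA mulmxBl AE subr0.
by rewrite mul_scalar_mx.
Qed.

End Resolvent.

(** To be read with [E] the projector of the deleted vertex, [P] that of the remaining ones and [Eo]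
    that of the target. The perturbation is E N (E + P) + P N E, and whatever meets Eo G' E on the
    left vanishes, so only P N E survives. *)
Lemma path_step_mx (K : pzRingType) D (G G' E P N Eo : 'M[K]_D) :
  G = G' + G' *m ((E + P) *m N *m (E + P) - P *m N *m P) *m G ->
  Eo *m G' *m E = 0 ->
  Eo *m G *m E = Eo *m G' *m P *m N *m E *m G *m E.
Proof.
move=> idG out; rewrite {1}idG 2!mulmxDl [X in _ + X - _]mulmxDr addrA addrK.
move: (E + P) => Q.
rewrite mulmxDr mulmxDl out add0r !mulmxA mulmxDr !mulmxDl !mulmxA out !mul0mx.
by rewrite add0r.
Qed.

(** The Schur complement. Compress (x - M_S) G = 1 by [r] on the left and [r^T] on the right; the
    last premise then expresses the off-diagonal part P G r^T in terms of r G r^T. *)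
Lemma diag_step_mx (K : comNzRingType) D d (x : K) (P G G' N : 'M[K]_D)
    (r : 'M[K]_(d, D)) :
  r *m r^T = 1%:M -> r *m P = 0 ->
  (x%:M - (r^T *m r + P) *m N *m (r^T *m r + P)) *m G = 1%:M ->
  P *m G *m (r^T *m r)
    = P *m G' *m P *m N *m (r^T *m r) *m G *m (r^T *m r) ->
  (x%:M - r *m N *m r^T - r *m N *m P *m G' *m P *m N *m r^T)
    *m (r *m G *m r^T) = 1%:M.
Proof.
move=> rK rP hG /(congr1 (fun Z => Z *m r^T)).
rewrite !mulmxA -!(mulmxA _ r) rK !mulmx1 => hP.
have rQ : r *m (r^T *m r + P) = r by rewrite mulmxDr mulmxA rK mul1mx rP addr0.
have <- : r *m ((x%:M - (r^T *m r + P) *m N *m (r^T *m r + P)) *m G) *m r^T = 1%:M.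
  by rewrite hG mulmx1.
rewrite !mulmxBl mulmxBr !mul_scalar_mx mulmxBl -scalemxAr -scalemxAl.
rewrite -addrA -opprD; congr (_ - _).
rewrite !mulmxA rQ mulmxDr !mulmxDl !mulmxA; congr (_ + _).
by rewrite -!(mulmxA (r *m N)) hP !mulmxA.
Qed.

(** * Deleting a vertex from the graph *)

Section VertexDeletion.
Variables (R : realType) (D n : nat) (V : 'I_n -> {set 'I_D}).
Variable M : 'M[R[i]]_D.
Hypothesis hV : is_partition V.
Local Notation C := R[i].
Local Notation ratfun := {fraction {poly C}}.
Local Notation X := (tofrac 'X : ratfun).
Local Notation MK := (map_mx (@ratcst R) M).
Local Notation r := (restr ratfun V).
Local Notation e := (proj V ratfun).
Local Notation P := (projS V ratfun).
Implicit Types (S : {set 'I_n}) (alpha omega mu nu : 'I_n) (p c : seq 'I_n).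

(** The size stays D for every S, so that resolvents of different subgraphs can be multiplied; on
    the coordinates outside of S this is X^-1 times the identity. *)
Definition subres S : 'M[ratfun]_D :=
  resolvent (projS V C S *m M *m projS V C S).

Lemma map_sub S :
  map_mx (@ratcst R) (projS V C S *m M *m projS V C S) = P S *m MK *m P S.
Proof. by rewrite !map_mxM map_projS. Qed.

Lemma blockFE mu nu : blockF V M mu nu = r mu *m MK *m (r nu)^T.
Proof. by rewrite /blockF /block !map_mxM -map_trmx !map_restr. Qed.

Lemma subres_out S omega nu : omega != nu -> nu \notin S ->
  e omega *m subres S *m e nu = 0.
Proof.
move=> ne nuS; rewrite -mulmxA resolvent_mul_eq0; last first.
  by rewrite map_sub -(mulmxA (_ *m _)) projS_proj // (negbTE nuS) mulmx0.
by rewrite -scalemxAr proj_orth // scaler0.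
Qed.

Lemma subres_identity S S' :
  subres S = subres S'
    + subres S' *m (P S *m MK *m P S - P S' *m MK *m P S') *m subres S.
Proof. by rewrite -!map_sub; exact: resolvent_identity. Qed.

Lemma subres_path S alpha omega : alpha \in S -> omega \in (S :\ alpha)%SET ->
  e omega *m subres S *m e alpha =
  e omega *m subres (S :\ alpha)%SET *m P (S :\ alpha)%SET *m MK
    *m e alpha *m subres S *m e alpha.
Proof.
move=> aS oS; have oa : omega != alpha by move: oS; rewrite !inE => /andP[].
have aS' : alpha \notin (S :\ alpha)%SET by rewrite !inE eqxx.
apply: path_step_mx; last exact: subres_out.
by rewrite -projSD1 //; exact: subres_identity.
Qed.

Lemma subres_diag S alpha : alpha \in S ->
  (X%:M - r alpha *m MK *m (r alpha)^T
     - r alpha *m MK *m P (S :\ alpha)%SET *m subres (S :\ alpha)%SET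
       *m P (S :\ alpha)%SET *m MK *m (r alpha)^T)
  *m (r alpha *m subres S *m (r alpha)^T) = 1%:M.
Proof.
move=> aS; have aS' : alpha \notin (S :\ alpha)%SET by rewrite !inE eqxx.
apply: (@diag_step_mx _ _ _ _ (P (S :\ alpha)%SET)).
- exact: restrK.
- by rewrite -[r alpha]restr_proj // -mulmxA proj_projS // (negbTE aS') mulmx0.
- by rewrite -projSD1 // -map_sub; exact: mulresV.
(* The last premise of [diag_step_mx] is [subres_path], collected over all omega in S minus alpha.
   The large matrices are generalized to keep rewriting cheap. *)
rewrite -/(e alpha); move: (fun omega oS => subres_path (omega := omega) aS oS).
move: (P _) (@eq_projS_mul _ _ V ratfun (S :\ alpha)%SET) => P' eqP.
move: (subres S) (subres (S :\ alpha)%SET) MK (e alpha) eqP.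
move=> G G' N E eqP h.
rewrite -!mulmxA; apply: eqP => omega oS.
by rewrite !mulmxA h.
Qed.

End VertexDeletion.

(** * Sums over paths and bare cycles *)

Section PathSum.
Variables (R : realType) (D n : nat) (V : 'I_n -> {set 'I_D}).
Variable M : 'M[R[i]]_D.
Hypothesis hV : is_partition V.
Local Notation C := R[i].
Local Notation ratfun := {fraction {poly C}}.
Local Notation MK := (map_mx (@ratcst R) M).
Local Notation r := (restr ratfun V).
Local Notation e := (proj V ratfun).
Local Notation P := (projS V ratfun).
Local Notation weights := ({set 'I_n} -> forall mu, 'M[ratfun]_#|V mu|).
Implicit Types (S : {set 'I_n}) (alpha omega mu nu : 'I_n) (p c : seq 'I_n).
Implicit Types F : weights.

(* Blocks are lifted to D x D matrices: the sizes of the blocks of a path vary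
   with the path, those of the lifted ones do not. *)
Definition lift_weight F S alpha : 'M[ratfun]_D :=
  (r alpha)^T *m F S alpha *m r alpha.

Fixpoint lift_path F S alpha p : 'M[ratfun]_D :=
  match p with
  | [::] => lift_weight F S alpha
  | nu :: p' =>
      lift_path F (S :\ alpha)%SET nu p' *m MK *m lift_weight F S alpha
  end.

Lemma lift_pathE F S alpha p :
  (r (last alpha p))^T *m path_weight M F S alpha p *m r alpha
  = lift_path F S alpha p.
Proof.
elim: p S alpha => [|nu p IHp] S alpha //=.
by rewrite -IHp blockFE /lift_weight !mulmxA.
Qed.

Lemma lift_path_proj F S alpha p :
  lift_path F S alpha p *m e alpha = lift_path F S alpha p.
Proof.
have lw : lift_weight F S alpha *m e alpha = lift_weight F S alpha.
  by rewrite /lift_weight -(mulmxA (_ *m _)) restr_proj.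
case: p => [|nu p]; first exact: lw.
by rewrite [lift_path _ _ _ _]/= -(mulmxA (_ *m MK)) lw.
Qed.

Lemma no_edge_blockF mu nu : ~~ edge V M mu nu -> blockF V M nu mu = 0.
Proof. by rewrite negbK /blockF => /eqP->; rewrite map_mx0. Qed.

Lemma all_setD1 S alpha p : all (fun v => v \in (S :\ alpha)%SET) p
  = (alpha \notin p) && all (fun v => v \in S) p.
Proof.
elim: p => //= v p ->; rewrite in_setD1 in_cons negb_or (eq_sym v).
by case: (alpha == v); case: (v \in S); case: (alpha \in p).
Qed.

Lemma is_path_nil S alpha omega :
  is_path V M S alpha omega [::] = (omega == alpha) && (alpha \in S).
Proof. by rewrite /is_path /= andbT eq_sym. Qed.

(** Never returning to [alpha] amounts to staying in the graph with [alpha] deleted, which also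
    rules out the self-loop that [edge0] forbids. *)
Lemma is_path_cons S alpha omega nu p :
  is_path V M S alpha omega (nu :: p) =
  [&& alpha \in S, edge V M alpha nu & is_path V M (S :\ alpha)%SET nu omega p].
Proof.
have pE : path (edge0 V M) alpha (nu :: p) =
    [&& alpha != nu, edge V M alpha nu & path (edge0 V M) nu p].
  by rewrite /= -andbA.
have aE : all (fun v => v \in S) (alpha :: nu :: p)
    = (alpha \in S) && all (fun v => v \in S) (nu :: p) by [].
rewrite /is_path pE all_setD1 aE (cons_uniq alpha) in_cons negb_or.
rewrite [last alpha _]/=.
move: (alpha \in S) (edge _ _ _ _) (path _ _ _) (uniq _) (_ == omega) (all _ _).
move: (alpha \in p) (alpha == nu).
by do 8!case.
Qed.

Lemma is_path_in S alpha omega p :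
  is_path V M S alpha omega p ->
  [/\ alpha \in S, omega \in S & last alpha p = omega].
Proof.
case/and4P => _ _ /eqP <- /allP inS.
by split; rewrite ?inS ?mem_head ?mem_last.
Qed.

Definition lift_sum F l S alpha omega : 'M[ratfun]_D :=
  \sum_(p : l.-tuple 'I_n | is_path V M S alpha omega p) lift_path F S alpha p.

Lemma lift_sum_out F l S alpha omega :
  ~~ ((alpha \in S) && (omega \in S)) -> lift_sum F l S alpha omega = 0.
Proof.
move=> out; rewrite /lift_sum big_pred0 // => p.
by apply: contraNF out => /is_path_in[-> ->].
Qed.

Lemma lift_sum0 F S alpha omega : lift_sum F 0 S alpha omega =
  if (omega == alpha) && (alpha \in S) then lift_weight F S alpha else 0.
Proof.
rewrite /lift_sum big_mkcond (big_pred1 [tuple]) /= ?is_path_nil // => p.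
by rewrite [p]tuple0; apply/esym/eqP.
Qed.

(** The sum on the right ignores whether [alpha] and [nu] are joined by an edge: a missing edge is a
    zero block of M. *)
Lemma lift_sumS F l S alpha omega : alpha \in S ->
  lift_sum F l.+1 S alpha omega =
  \sum_(nu in (S :\ alpha)%SET)
     lift_sum F l (S :\ alpha)%SET nu omega *m MK *m lift_weight F S alpha.
Proof.
move=> aS; rewrite /lift_sum.
rewrite (big_tuple_cons _ (is_path V M S alpha omega) (lift_path F S alpha)).
rewrite [RHS]big_mkcond; apply: eq_bigr => nu _.
under eq_bigl => p do rewrite is_path_cons aS /=.
case: ifPn => nuS; last first.
  rewrite big_pred0 // => p; apply: contraNF nuS => /andP[_].
  by case/is_path_in.
rewrite !mulmx_suml; case: (boolP (edge V M alpha nu)) => /= [//|ne].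
rewrite big_pred0 // big1 // => p _.
have rNr : r nu *m MK *m (r alpha)^T = 0 by rewrite -blockFE no_edge_blockF.
(* Inserting the projector of [nu] makes the zero block of M at (nu, alpha) appear. *)
rewrite -lift_path_proj /proj /lift_weight !mulmxA.
move: (lift_path _ _ _ _) (F S alpha) rNr => L f rNr.
by rewrite -!(mulmxA (L *m (r nu)^T)) rNr !mul0mx mulmx0.
Qed.

(** The induction hypothesis on F. It is kept as a condition on single vertex sets, so that the sums
    over a smaller graph can be evaluated before the claim is known for S. *)
Definition diag_of_subres F S := forall alpha, alpha \in S ->
  F S alpha = r alpha *m subres V M S *m (r alpha)^T.

Lemma lift_weight_subres F S alpha : diag_of_subres F S -> alpha \in S ->
  lift_weight F S alpha = e alpha *m subres V M S *m e alpha.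
Proof. by move=> gS aS; rewrite /lift_weight gS // /proj !mulmxA. Qed.

(** Removing the first vertex of the paths gives the same recursion as [subres_path] does for the
    resolvent. Any [m] not below the number of vertices will do, since longer paths do not exist. *)
Lemma sum_lift_sum F m S alpha omega :
    (forall T : {set 'I_n}, T \subset S -> diag_of_subres F T) ->
    alpha \in S -> omega \in S -> (#|S| <= m)%N ->
  \sum_(0 <= l < m) lift_sum F l S alpha omega
    = e omega *m subres V M S *m e alpha.
Proof.
elim: m S alpha => [|m IHm] S alpha gF aS oS leSm.
  by move: leSm aS; rewrite leqn0 cards_eq0 => /eqP->; rewrite inE.
have lw : lift_weight F S alpha = e alpha *m subres V M S *m e alpha.
  by apply: lift_weight_subres => //; exact: gF.
rewrite big_nat_recl; last by [].
rewrite lift_sum0 aS andbT.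
under eq_bigr do rewrite (lift_sumS _ _ _ aS).
(* If omega = alpha only the path of length zero counts: once left, [alpha] is deleted and cannot be
   the endpoint. *)
case: eqP => [->|/eqP oa].
  rewrite lw big1 ?addr0 // => l _; rewrite big1 // => nu _.
  by rewrite lift_sum_out ?mul0mx // !inE eqxx /= andbF.
have oS' : omega \in (S :\ alpha)%SET by rewrite !inE oa.
have lwE Z : Z *m e alpha *m subres V M S *m e alpha = Z *m lift_weight F S alpha.
  by rewrite lw !mulmxA.
rewrite add0r exchange_big (subres_path _ hV aS oS') lwE.
rewrite /projS mulmx_sumr !mulmx_suml; apply: eq_bigr => nu nuS.
rewrite -!mulmx_suml (IHm _ _ _ nuS oS') // => [T TS|].
  by apply: gF; apply: (fintype.subset_trans TS); rewrite subD1set.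
by move: leSm; rewrite (cardsD1 alpha) aS.
Qed.

(** [is_path] with a free endpoint, as needed for the interior of a bare cycle. *)
Definition in_path S alpha p : bool :=
  [&& path (edge0 V M) alpha p, uniq (alpha :: p)
    & all (fun v => v \in S) (alpha :: p)].

Lemma is_pathE S alpha omega p :
  is_path V M S alpha omega p = in_path S alpha p && (last alpha p == omega).
Proof. by rewrite /is_path /in_path -!andbA; do !bool_congr. Qed.

Lemma is_bare_cycle_cons S alpha mu c : alpha \in S ->
  is_bare_cycle V M S alpha (mu :: c) =
  [&& in_path (S :\ alpha)%SET mu c, edge V M alpha mu
    & edge V M (last mu c) alpha].
Proof.
move=> aS.
have cE : cycle (edge0 V M) (alpha :: mu :: c) =
    [&& alpha != mu, edge V M alpha mu, path (edge0 V M) mu c,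
        last mu c != alpha & edge V M (last mu c) alpha].
  by rewrite /= rcons_path -andbA.
have aE : all (fun v => v \in S) (alpha :: mu :: c)
    = all (fun v => v \in S) (mu :: c) by rewrite /= aS.
have lE : alpha \notin mu :: c -> last mu c != alpha.
  by apply: contraNneq => <-; exact: mem_last.
rewrite /is_bare_cycle /ucycleb /in_path cE aE all_setD1 (cons_uniq alpha).
move: lE; rewrite in_cons negb_or; case: (alpha == mu) => /=.
  by rewrite ?andbF.
case: (alpha \in c) => /=; first by rewrite ?andbF.
move=> -> //=.
move: (edge _ _ _ _) (path _ _ _) (uniq _) (edge _ _ _ _) (all _ _) (mu \in S).
move: (mu \in c).
by do 7!case.
Qed.

(** A bare cycle is a path avoiding [alpha], from mu to omega, closed up by two edges at [alpha]. As
    missing edges are zero blocks, mu and omega may range over all vertices. *)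
Lemma sum_cycle_weight F k S alpha : alpha \in S ->
  \sum_(c : k.+1.-tuple 'I_n | is_bare_cycle V M S alpha c)
     cycle_weight M F S alpha c
  = \sum_mu \sum_omega r alpha *m MK
      *m lift_sum F k (S :\ alpha)%SET mu omega *m MK *m (r alpha)^T.
Proof.
move=> aS.
rewrite (big_tuple_cons _ (is_bare_cycle V M S alpha) (cycle_weight M F S alpha)).
apply: eq_bigr => mu _; rewrite big_mkcond.
under [RHS]eq_bigr => omega _ do rewrite mulmx_sumr !mulmx_suml big_mkcond.
rewrite exchange_big; apply: eq_bigr => c _ /=.
rewrite -big_mkcond /= is_bare_cycle_cons //.
under eq_bigl => omega do rewrite is_pathE.
have cwE : cycle_weight M F S alpha (mu :: c) =
    blockF V M alpha (last mu c) *m path_weight M F (S :\ alpha)%SET mu c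
      *m blockF V M mu alpha by [].
have cw : cycle_weight M F S alpha (mu :: c) =
    r alpha *m MK *m lift_path F (S :\ alpha)%SET mu c *m MK *m (r alpha)^T.
  by rewrite cwE -lift_pathE !blockFE !mulmxA.
case: (in_path _ _ _); last by rewrite big_pred0.
rewrite (big_pred1 (last mu c)) => [|omega]; last by rewrite eq_sym.
rewrite -cw cwE; case: (boolP (edge V M alpha mu)) => e1; last first.
  by rewrite (no_edge_blockF e1) mulmx0.
case: (boolP (edge V M _ alpha)) => e2; first by [].
by rewrite (no_edge_blockF e2) !mul0mx.
Qed.

(** Without internal vertices the cycle would be a self-loop, which [edge0] excludes; the diagonal
    block enters [Finv] separately. *)
Lemma cycle_sum0 F S alpha :
  \sum_(c : 0.-tuple 'I_n | is_bare_cycle V M S alpha c)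
     cycle_weight M F S alpha c = 0.
Proof.
have nil : is_bare_cycle V M S alpha [::] = false.
  by rewrite /is_bare_cycle /ucycleb [cycle _ _]/= /edge0 /= eqxx.
by rewrite big_pred0 // => c; rewrite (tuple0 c); exact: nil.
Qed.

Lemma cycle_sumE F S alpha :
    (forall T : {set 'I_n}, T \subset (S :\ alpha)%SET -> diag_of_subres F T) ->
    alpha \in S ->
  cycle_sum M F S alpha =
    r alpha *m MK *m P (S :\ alpha)%SET *m subres V M (S :\ alpha)%SET
       *m P (S :\ alpha)%SET *m MK *m (r alpha)^T.
Proof.
move=> gF aS; have n0 : (0 < n)%N by case: (n) alpha {gF aS} => // -[].
rewrite /cycle_sum -(big_mkord xpredT (fun k => \sum_(c : k.-tuple 'I_n |
  is_bare_cycle V M S alpha c) cycle_weight M F S alpha c)).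
rewrite big_ltn // cycle_sum0 add0r big_add1.
under eq_bigr do rewrite sum_cycle_weight //.
(* After the shift of index [n.-1] path lengths remain, which suffices for [sum_lift_sum] on S minus
   alpha. *)
have leS : (#|(S :\ alpha)%SET| <= n.-1)%N.
  rewrite -ltnS prednK //; have := max_card (mem S); rewrite card_ord.
  by rewrite (cardsD1 alpha) aS.
rewrite exchange_big /=.
transitivity (\sum_(mu in (S :\ alpha)%SET) \sum_(omega in (S :\ alpha)%SET)
  r alpha *m MK *m (e omega *m subres V M (S :\ alpha)%SET *m e mu)
    *m MK *m (r alpha)^T); last first.
  rewrite -(mulmxA (_ *m MK)) -(mulmxA (_ *m MK)).
  rewrite exchange_big /= /projS !mulmx_suml mulmx_sumr !mulmx_suml.
  apply: eq_bigr => omega _; rewrite !mulmx_sumr !mulmx_suml.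
  by apply: eq_bigr => mu _; rewrite !mulmxA.
rewrite [RHS]big_mkcond; apply: eq_bigr => mu _.
rewrite exchange_big /=; case: ifPn => muS; last first.
  rewrite big1 // => omega _; rewrite big1 // => k _.
  by rewrite lift_sum_out ?mulmx0 ?mul0mx // (negbTE muS).
rewrite [RHS]big_mkcond; apply: eq_bigr => omega _.
case: ifPn => oS; last first.
  rewrite big1 // => k _.
  by rewrite lift_sum_out ?mulmx0 ?mul0mx // (negbTE oS) andbF.
by rewrite -!mulmx_suml -mulmx_sumr sum_lift_sum.
Qed.

(** Strong induction on the number of vertices. By [cycle_sumE] the Schur complement in
    [subres_diag] is [Finv], so [Finv] times the diagonal block of G_S is 1, which yields both
    claims. *)
Lemma Fmx_subres S alpha : alpha \in S ->
  Finv M (Fmx V M) S alpha \in unitmx /\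
  Fmx V M S alpha = r alpha *m subres V M S *m (r alpha)^T.
Proof.
have [m] := ubnP #|S|; elim: m S alpha => // m IHm S alpha leSm aS.
have := subres_diag M hV aS; rewrite -(@cycle_sumE (Fmx V M)) //; last first.
  move=> T TS beta bT; apply: (IHm _ _ _ bT).2.
  rewrite (leq_ltn_trans (subset_leq_card TS)) //.
  by move: leSm; rewrite (cardsD1 alpha) aS.
rewrite -blockFE -/(Finv M (Fmx V M) S alpha) FmxE // => h.
have [u _] := mulmx1_unit h; split => //.
by rewrite -[RHS](mulKmx u) h mulmx1.
Qed.

Lemma path_sum_resolvent alpha omega :
  path_sum M (Fmx V M) [set: 'I_n]%SET alpha omega =
  block V (resolvent M) omega alpha.
Proof.
have -> : resolvent M = subres V M [set: 'I_n]%SET.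
  by rewrite /subres (projST hV) mul1mx mulmx1.
have h : (r omega)^T *m path_sum M (Fmx V M) [set: 'I_n]%SET alpha omega
    *m r alpha = e omega *m subres V M [set: 'I_n]%SET *m e alpha.
  rewrite -(@sum_lift_sum (Fmx V M) n) ?inE //; last first.
  - by rewrite cardsT card_ord.
  - by move=> T _ beta bT; exact: (Fmx_subres bT).2.
  rewrite big_mkord mulmx_sumr mulmx_suml; apply: eq_bigr => l _.
  rewrite mulmx_sumr mulmx_suml; apply: eq_bigr => p /is_path_in[_ _ <-].
  by rewrite conform_mx_id lift_pathE.
(* Compressing by the restrictions undoes the lifting to size D, by [restrK]. *)
rewrite /block -[LHS]mul1mx -[LHS]mulmx1 -(restrK V ratfun omega).
rewrite -(restrK V ratfun alpha) -!mulmxA (mulmxA (r omega)^T) (mulmxA _ (r alpha)).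
by rewrite h /proj !mulmxA restrK mul1mx -!(mulmxA _ (r alpha)) restrK mulmx1.
Qed.

End PathSum.

(** * Rational functions *)

(** Separates two distinct poles: for x = X - lambda and y = X - mu the difference y - x is a
    constant. *)
Lemma div_div_diff (K : fieldType) (g x y : K) :
  x != 0 -> y != 0 -> y - x != 0 ->
  g / x / y = (y - x)^-1 * (g / x - g / y).
Proof. by move=> x0 y0 d0; field; rewrite x0 y0 d0. Qed.

Section RationalFunctions.
Variable R : realType.
Local Notation C := R[i].
Local Notation ratfun := {fraction {poly C}}.
Local Notation X := (tofrac 'X : ratfun).
Local Notation cst := (@ratcst R).
Implicit Types (p q : {poly C}) (g h : ratfun) (a b : nat -> C) (c lambda mu : C).

Let ratcstD c mu : cst (c + mu) = cst c + cst mu.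
Proof. exact: rmorphD. Qed.

Let ratcstM c mu : cst (c * mu) = cst c * cst mu.
Proof. exact: rmorphM. Qed.

Let ratcstN1 g : cst (-1) * g = - g.
Proof. by rewrite rmorphN1 mulN1r. Qed.

Definition proper g :=
  exists p q, (size p < size q)%N /\ g = tofrac p / tofrac q.

Lemma proper_denom p q : (size p < size q)%N -> q != 0.
Proof. by move=> lt; rewrite -size_poly_gt0 (leq_ltn_trans _ lt). Qed.

Lemma proper0 : proper 0.
Proof.
exists 0, 1; split.
  by rewrite (@leq_ltn_trans 0) ?size_poly_leq0 ?size_poly_gt0 ?oner_eq0.
by rewrite rmorph0 mul0r.
Qed.

Lemma properD g h : proper g -> proper h -> proper (g + h).
Proof.
move=> [p [q [ltpq ->]]] [p' [q' [ltpq' ->]]].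
have q0 := proper_denom ltpq; have q0' := proper_denom ltpq'.
exists (p * q' + p' * q), (q * q'); split; last first.
  by rewrite addf_div ?tofrac_eq0 // rmorphD /= !rmorphM.
rewrite size_mul // (leq_ltn_trans (size_polyD _ _)) // gtn_max.
have aux (u v w : {poly C}) : (size u < size w)%N -> v != 0 ->
    (size (u * v)%R < (size w + size v).-1)%N.
  move=> lt v0; have [->|u0] := eqVneq u 0.
    rewrite mul0r size_poly0; move: v0; rewrite -size_poly_gt0.
    by case: (size w) lt => // m _; case: (size v) => // k _; rewrite addnS.
  rewrite size_mul //; move: u0 v0; rewrite -!size_poly_gt0.
  move: (size u) (size v) (size w) lt => [|x] [|y] [|z] //.
  by rewrite !addnS /= ltn_add2r.
by rewrite aux // addnC aux.
Qed.

Lemma properZ c g : proper g -> proper (cst c * g).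
Proof.
move=> [p [q [ltpq ->]]]; exists (c *: p), q; split.
  exact: leq_ltn_trans (size_scale_leq _ _) ltpq.
by rewrite -mul_polyC rmorphM mulrA.
Qed.

Lemma tofrac_XsubC_neq0 mu : tofrac ('X - mu%:P) != 0 :> ratfun.
Proof. by rewrite tofrac_eq0 polyXsubC_eq0. Qed.

Lemma proper_div g c mu :
  proper g -> proper ((g + cst c) / tofrac ('X - mu%:P)).
Proof.
move=> [p [q [ltpq ->]]]; have q0 := proper_denom ltpq.
exists (p + c *: q), (q * ('X - mu%:P)); split.
  rewrite size_mul ?polyXsubC_eq0 // size_XsubC addn2 /= ltnS.
  rewrite (leq_trans (size_polyD _ _)) // geq_max (ltnW ltpq).
  exact: size_scale_leq.
rewrite tofracM invfM mulrA; congr (_ / _).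
rewrite -mul_polyC tofracD tofracM.
by rewrite mulrDl mulfK // tofrac_eq0.
Qed.

Lemma proper_tofrac p : proper (tofrac p) -> p = 0.
Proof.
move=> [p' [q [lt e]]]; have q0 := proper_denom lt.
have [->//|p0] := eqVneq p 0.
have {e} : tofrac (p * q) == tofrac p'.
  by rewrite rmorphM /= e divfK // tofrac_eq0.
rewrite tofrac_eq => /eqP e; move: lt; rewrite -e size_mul // ltnNge.
by move: p0; rewrite -size_poly_gt0; case: (size p) => // k _; rewrite leq_addl.
Qed.

(* X^k times the remainder of order k of the expansion of g at infinity: a is
   that expansion, g = sum_m a_m X^(-m-1), when all of these are proper. *)
Fixpoint expansion_rem g a k : ratfun :=
  if k is k'.+1 then X * expansion_rem g a k' - cst (a k') else g.

Definition expansion g a := forall k, proper (expansion_rem g a k).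

Lemma expansionD g h a b :
  expansion g a -> expansion h b -> expansion (g + h) (fun m => a m + b m).
Proof.
move=> ea eb k; suff -> : expansion_rem (g + h) (fun m => a m + b m) k
    = expansion_rem g a k + expansion_rem h b k by exact: properD.
elim: k => //= k ->; rewrite rmorphD mulrDr; set u := X * _; set v := X * _.
by rewrite opprD addrACA.
Qed.

Lemma expansionZ c g a :
  expansion g a -> expansion (cst c * g) (fun m => c * a m).
Proof.
move=> ea k; suff -> : expansion_rem (cst c * g) (fun m => c * a m) k
    = cst c * expansion_rem g a k by exact: properZ.
by elim: k => //= k ->; rewrite rmorphM mulrBr; congr (_ - _); rewrite mulrCA.
Qed.

Lemma expansion0 : expansion 0 (fun=> 0).
Proof.
move=> k; suff -> : expansion_rem 0 (fun=> 0) k = 0 by exact: proper0.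
by elim: k => //= k ->; rewrite rmorph0 mulr0 subr0.
Qed.

(** As long as the remainders vanish, the next one is the constant - a_k, and a strictly proper
    constant is 0. *)
Lemma expansion_eq0 a : expansion 0 a -> forall k, a k = 0.
Proof.
move=> ea.
have step k : expansion_rem 0 a k = 0 -> a k = 0.
  move=> e; have := ea k.+1; rewrite /= e mulr0 sub0r -rmorphN => /proper_tofrac.
  by move/eqP; rewrite polyC_eq0 oppr_eq0 => /eqP.
suff h k : expansion_rem 0 a k = 0 by move=> k; exact: step.
by elim: k => //= k IHk; rewrite (step k) // IHk rmorph0 mulr0 subr0.
Qed.

Lemma expansion_uniq g a b : expansion g a -> expansion g b -> a =1 b.
Proof.
move=> ea /(expansionZ (-1)) eb k; apply/eqP; rewrite -subr_eq0; apply/eqP.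
have := expansionD ea eb; rewrite rmorphN rmorph1 mulN1r subrr => /expansion_eq0.
by move/(_ k); rewrite mulN1r.
Qed.

(** The recurrence compares coefficients in (X - mu) h = g. The remainder of order k of the quotient
    is that of [g] plus b_k, divided by X - mu. *)
Lemma expansion_div g a b mu :
  b 0%N = 0 -> (forall k, b k.+1 = mu * b k + a k) ->
  expansion g a -> expansion (g / tofrac ('X - mu%:P)) b.
Proof.
move=> b0 bS ea k.
suff -> : expansion_rem (g / tofrac ('X - mu%:P)) b k
  = (expansion_rem g a k + cst (b k)) / tofrac ('X - mu%:P) by exact: proper_div.
elim: k => [|k IHk] /=; first by rewrite b0 rmorph0 addr0.
rewrite IHk bS; apply: (mulIf (tofrac_XsubC_neq0 mu)).
rewrite divfK ?tofrac_XsubC_neq0 // mulrBl mulrA divfK ?tofrac_XsubC_neq0 //.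
rewrite tofracB -[tofrac mu%:P]/(cst mu) ratcstD ratcstM.
move: (expansion_rem _ _ _) X (cst mu) (cst (b k)) (cst (a k)) => u x m y z.
by ring.
Qed.

(** The remainder of order k is the entry of M^k (X - M)^-1, a linear combination of column [j] of
    the resolvent. *)
Lemma resolvent_expansion D (M : 'M[C]_D) i j :
  (forall k, proper (resolvent M k j)) ->
  expansion (resolvent M i j) (fun m => (M ^+ m) i j).
Proof.
move=> pr k.
suff -> : expansion_rem (resolvent M i j) (fun m => (M ^+ m) i j) k
   = (map_mx cst (M ^+ k) *m resolvent M) i j.
  rewrite mxE; apply: (big_ind proper) => [||l _]; first exact: proper0.
    exact: properD.
  by rewrite mxE; exact: properZ.
elim: k => [|k IHk] /=; first by rewrite expr0 map_mx1 mul1mx.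
have h : map_mx cst M *m resolvent M = X *: resolvent M - 1%:M.
  by rewrite -(mulresV M) mulmxBl mul_scalar_mx opprB addrCA subrr addr0.
rewrite IHk exprSr -mulmxE map_mxM -mulmxA h.
by rewrite mulmxBr mulmx1 -scalemxAr !mxE.
Qed.

(** The shifted exponent makes this the Laplace transform of t^j exp(lambda t) / j!. *)
Definition pole lambda j : ratfun := (tofrac ('X - lambda%:P))^-1 ^+ j.+1.

Lemma pole0 lambda : pole lambda 0 = (tofrac ('X - lambda%:P))^-1.
Proof. exact: expr1. Qed.

Lemma poleS lambda j : pole lambda j.+1 = pole lambda j / tofrac ('X - lambda%:P).
Proof. exact: exprSr. Qed.

(** Repeated poles are allowed, so that adding two decompositions is mere concatenation. *)
Inductive partial_fraction : ratfun -> Prop :=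
| PFrac0 : partial_fraction 0
| PFracD c lambda j g : partial_fraction g ->
    partial_fraction (cst c * pole lambda j + g).

Lemma pfracD g h :
  partial_fraction g -> partial_fraction h -> partial_fraction (g + h).
Proof.
by move=> pg ph; elim: pg => [|*]; rewrite ?add0r // -addrA; constructor.
Qed.

Lemma pfracZ c g : partial_fraction g -> partial_fraction (cst c * g).
Proof.
elim => [|d lambda j f _ IHf]; first by rewrite mulr0; constructor.
by rewrite mulrDr mulrA -rmorphM; constructor.
Qed.

Lemma pfrac_pole lambda j : partial_fraction (pole lambda j).
Proof.
by rewrite -[pole _ _]addr0 -[pole _ _]mul1r -(rmorph1 cst); do 2!constructor.
Qed.

(** For lambda = mu the order of the pole goes up by one. Otherwise [div_div_diff] splits off a pole
    at lambda and leaves the same problem with j lowered by one. *)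
Lemma pole_div lambda mu j :
  partial_fraction (pole lambda j / tofrac ('X - mu%:P)).
Proof.
have [->|ne] := eqVneq lambda mu.
  by rewrite -poleS; exact: pfrac_pole.
have y0 := tofrac_XsubC_neq0 mu; have x0 := tofrac_XsubC_neq0 lambda.
have xy : tofrac ('X - mu%:P) - tofrac ('X - lambda%:P) = cst (lambda - mu).
  by rewrite -rmorphB opprB addrC addrA subrK -polyCB.
have d0 : cst (lambda - mu) != 0 by rewrite fmorph_eq0 subr_eq0.
have stepE : forall g, g / tofrac ('X - lambda%:P) / tofrac ('X - mu%:P)
  = cst (lambda - mu)^-1 * (g / tofrac ('X - lambda%:P)
      + cst (-1) * (g / tofrac ('X - mu%:P))).
  have cV : cst (lambda - mu)^-1 = (cst (lambda - mu))^-1 by exact: fmorphV.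
  move=> g; rewrite cV ratcstN1 -xy; rewrite -xy in d0.
  by rewrite (div_div_diff g x0 y0 d0).
elim: j => [|j IHj].
  rewrite pole0 -[_^-1]mul1r stepE !mul1r -!pole0.
  by apply/pfracZ/pfracD; [|apply: pfracZ]; exact: pfrac_pole.
rewrite poleS stepE -poleS; apply/pfracZ/pfracD; first exact: pfrac_pole.
exact/pfracZ/IHj.
Qed.

Lemma pfrac_div g mu :
  partial_fraction g -> partial_fraction (g / tofrac ('X - mu%:P)).
Proof.
elim => [|c lambda j f _ IHf]; first by rewrite mul0r; constructor.
by rewrite mulrDl -mulrA; apply: pfracD => //; apply/pfracZ/pole_div.
Qed.

Lemma resolvent_pfrac D (M : 'M[C]_D) i j : partial_fraction (resolvent M i j).
Proof.
case: D M i j => [M []//|D] M i j.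
pose P (rs : seq C) : 'M[C]_D.+1 := \prod_(z <- rs) (M - z%:M).
pose w (rs : seq C) : ratfun := \prod_(z <- rs) (tofrac ('X - z%:P))^-1.
have w_pf z rs : partial_fraction (w (z :: rs)).
  elim: rs z => [|y rs IHrs] z; rewrite /w big_cons.
    by rewrite big_nil mulr1 -pole0; exact: pfrac_pole.
  by rewrite mulrC; apply: pfrac_div; exact: IHrs.
(* Telescoping, as in Putzer's algorithm; Cayley-Hamilton removes the last
   term when rs lists the eigenvalues. *)
have key rs : exists2 H : 'M[ratfun]_D.+1,
    forall i j, partial_fraction (H i j) &
    (X%:M - map_mx cst M) *m H = 1%:M - w rs *: map_mx cst (P rs).
  elim: rs => [|z rs [H H_pf HE]].
    exists 0 => [? ?|]; first by rewrite mxE; constructor.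
    by rewrite mulmx0 /w /P !big_nil map_mx1 scale1r subrr.
  exists (H + w (z :: rs) *: map_mx cst (P rs)) => [k l|].
    rewrite !mxE; apply: pfracD => //; rewrite mulrC.
    exact/pfracZ/w_pf.
  (* Write X - M as (X - z) - (M - z): the first part turns [w (z :: rs)] into [w rs], the second
     turns [P rs] into [P (z :: rs)]. *)
  suff E : (X%:M - map_mx cst M) *m (w (z :: rs) *: map_mx cst (P rs))
      = w rs *: map_mx cst (P rs) - w (z :: rs) *: map_mx cst (P (z :: rs)).
    by rewrite mulmxDr HE E addrA subrK.
  have wE : w rs = w (z :: rs) * tofrac ('X - z%:P).
    by rewrite /w big_cons mulrAC mulVf ?mul1r // tofrac_XsubC_neq0.
  rewrite wE -scalerA -scalerBr -scalemxAr; congr (_ *: _).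
  have -> : P (z :: rs) = (M - z%:M) *m P rs by rewrite /P big_cons.
  rewrite map_mxM -mul_scalar_mx -mulmxBl.
  congr (_ *m _); rewrite map_mxB map_scalar_mx tofracB raddfB /=.
  by rewrite opprB addrA subrK.
have [rs rsE] : exists rs : seq C, char_poly M = \prod_(z <- rs) ('X - z%:P).
  have [rs rsE] := closed_field_poly_normal (char_poly M); exists rs.
  by rewrite rsE (eqP (char_poly_monic M)) scale1r.
have P0 : P rs = 0.
  rewrite -[RHS](Cayley_Hamilton M) rsE rmorph_prod; apply: eq_bigr => z _.
  by rewrite rmorphB /= horner_mx_X horner_mx_C.
have [H H_pf] := key rs; rewrite P0 map_mx0 scaler0 subr0 => h.
suff -> : resolvent M = H by exact: H_pf.
by rewrite -[RHS]mul1mx -(mulVres M) -mulmxA h mulmx1.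
Qed.

(** Validity on some right half plane, as in [is_inv_laplace]; such a half plane can be chosen to
    avoid the finitely many zeros of the denominators. *)
Definition large_Re (Q : C -> Prop) :=
  exists sigma : R, forall s : C, sigma < complex.Re s -> Q s.

Lemma large_Re_and (Q1 Q2 : C -> Prop) :
  large_Re Q1 -> large_Re Q2 -> large_Re (fun s => Q1 s /\ Q2 s).
Proof.
move=> [x1 h1] [x2 h2]; exists (Num.max x1 x2) => s.
by rewrite gt_max => /andP[/h1 ? /h2 ?].
Qed.

Lemma large_Re_imp (Q1 Q2 : C -> Prop) :
  (forall s, Q1 s -> Q2 s) -> large_Re Q1 -> large_Re Q2.
Proof. by move=> h [x hx]; exists x => s /hx/h. Qed.

Lemma large_Re_ex Q : large_Re Q -> exists s, Q s.
Proof. by move=> [x hx]; exists (x + 1)%:C; apply: hx; rewrite /= ltrDl. Qed.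

Lemma large_Re_neq_poly q : q != 0 -> large_Re (fun s => q.[s] != 0).
Proof.
move=> q0; have [rs ->] := closed_field_poly_normal q.
have [sigma hs] : large_Re (fun s => (\prod_(z <- rs) ('X - z%:P)).[s] != 0).
  elim: rs => [|z rs IHrs].
    by exists 0 => s _; rewrite big_nil hornerC oner_eq0.
  have hz : large_Re (fun s => s != z).
    by exists (complex.Re z) => s; apply: contraTneq => ->; rewrite ltxx.
  apply: large_Re_imp (large_Re_and hz IHrs) => s [sz hs].
  by rewrite big_cons hornerM mulf_neq0 // hornerXsubC subr_eq0.
exists sigma => s /hs; rewrite hornerZ => h.
by rewrite mulf_neq0 // lead_coef_eq0.
Qed.

Lemma pi_fracE (x : {ratio {poly C}}) :
  \pi_{fraction {poly C}}%qT x = tofrac x.1 / tofrac x.2.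
Proof.
unlock tofrac; rewrite -[X in _ * X]FracField.pi_inv -[RHS]FracField.pi_mul.
rewrite /FracField.mulf /FracField.invf !numden_Ratio ?oner_neq0 ?denom_ratioP //.
by rewrite mulr1 mul1r Ratio_numden.
Qed.

(** [ratfun_eval] uses a chosen representative. Cross-multiplying it with p / q gives an identity of
    polynomials, which determines the value wherever neither denominator vanishes. *)
Lemma ratfun_evalE p q : q != 0 ->
  large_Re (fun s => q.[s] != 0 /\ ratfun_eval (tofrac p / tofrac q) s = p.[s] / q.[s]).
Proof.
move=> q0; set g := _ / _.
have d0 : (repr g).2 != 0 := denom_ratioP (repr g).
have ev := large_Re_and (large_Re_neq_poly q0) (large_Re_neq_poly d0).
apply: large_Re_imp ev => s [hq hd].
split=> //; rewrite /ratfun_eval.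
have : g = tofrac (repr g).1 / tofrac (repr g).2 by rewrite -pi_fracE reprK.
move/eqP; rewrite eqr_div ?tofrac_eq0 // -!rmorphM tofrac_eq => /eqP.
move/(congr1 (horner^~ s)); rewrite !hornerM => h.
by apply/eqP; rewrite eqr_div // h mulrC.
Qed.

Lemma ratfun_fracE g : exists p q, q != 0 /\ g = tofrac p / tofrac q.
Proof.
exists (repr g).1, (repr g).2; split; first exact: denom_ratioP.
by rewrite -pi_fracE reprK.
Qed.

Lemma ratfun_evalD g h :
  large_Re (fun s => ratfun_eval (g + h) s = ratfun_eval g s + ratfun_eval h s).
Proof.
have [p [q [q0 ->]]] := ratfun_fracE g; have [p' [q' [q0' ->]]] := ratfun_fracE h.
have -> : tofrac p / tofrac q + tofrac p' / tofrac q'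
    = tofrac (p * q' + p' * q) / tofrac (q * q') :> ratfun.
  by rewrite addf_div ?tofrac_eq0 // tofracD !tofracM.
have ev := large_Re_and (ratfun_evalE p q0) (ratfun_evalE p' q0').
have ev' := ratfun_evalE (p * q' + p' * q) (mulf_neq0 q0 q0').
apply: large_Re_imp (large_Re_and ev ev').
move=> s [[[h1 ->] [h2 ->]] [_ ->]].
by rewrite addf_div // hornerD !hornerM.
Qed.

Lemma ratfun_evalZ c g :
  large_Re (fun s => ratfun_eval (cst c * g) s = c * ratfun_eval g s).
Proof.
have [p [q [q0 ->]]] := ratfun_fracE g.
have -> : cst c * (tofrac p / tofrac q) = tofrac (c *: p) / tofrac q.
  by rewrite -mul_polyC tofracM mulrA.
apply: large_Re_imp (large_Re_and (ratfun_evalE p q0) (ratfun_evalE (c *: p) q0)).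
by move=> s [[_ ->] [_ ->]]; rewrite hornerZ mulrA.
Qed.

Lemma ratfun_eval0 : large_Re (fun s => ratfun_eval 0 s = 0).
Proof.
have := ratfun_evalE 0 (oner_neq0 {poly C}); rewrite tofrac0 mul0r.
by apply: large_Re_imp => s [_ ->]; rewrite horner0 mul0r.
Qed.

Lemma ratfun_eval_pole lambda j :
  large_Re (fun s => ratfun_eval (pole lambda j) s = (s - lambda)^-1 ^+ j.+1).
Proof.
have q0 : ('X - lambda%:P) ^+ j.+1 != 0 by rewrite expf_neq0 ?polyXsubC_eq0.
have -> : pole lambda j = tofrac 1 / tofrac (('X - lambda%:P) ^+ j.+1).
  by rewrite /pole tofrac1 mul1r tofracXn exprVn.
apply: large_Re_imp (ratfun_evalE 1 q0) => s [_ ->].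
by rewrite hornerC mul1r horner_exp hornerXsubC exprVn.
Qed.

(** A nonzero cross difference of numerators and denominators would have no root far to the right,
    where the equality of values makes it vanish. *)
Lemma ratfun_eval_inj g h :
  large_Re (fun s => ratfun_eval g s = ratfun_eval h s) -> g = h.
Proof.
have [p [q [q0 ->]]] := ratfun_fracE g; have [p' [q' [q0' ->]]] := ratfun_fracE h.
have ev := large_Re_and (ratfun_evalE p q0) (ratfun_evalE p' q0').
move=> eqgh; apply/eqP; rewrite eqr_div ?tofrac_eq0 // -!tofracM tofrac_eq.
rewrite -subr_eq0; apply: contraT => /large_Re_neq_poly ne.
have /large_Re_ex := large_Re_and (large_Re_and eqgh ev) ne.
move=> [s [[e [[h1 h1'] [h2 h2']]]]].
case/negP; move/eqP: e; rewrite h1' h2' eqr_div // => /eqP e.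
by rewrite hornerD hornerN !hornerM e subrr.
Qed.

End RationalFunctions.

(** * The complex exponential series *)

Section ExpSum.
Variable K : numFieldType.
Implicit Types (x y z : K) (N : nat).

Definition exp_sum z N : K := \sum_(k < N) z ^+ k / k`!%:R.

Let term x y (i j : nat) : K := (x ^+ j / j`!%:R) * (y ^+ i / i`!%:R).

(** By the binomial theorem the double sum runs over the triangle i + j < N, against the full square
    for the product in [exp_sumM]. *)
Lemma exp_sumD x y N :
  exp_sum (x + y) N = \sum_(i < N) \sum_(j < N - i) term x y i j.
Proof.
elim: N => [|N IHN]; first by rewrite /exp_sum !big_ord0.
rewrite /exp_sum big_ord_recr -/(exp_sum _ N) IHN /=.
(* Passing from N to N + 1 adds the diagonal i + j = N; the inner sum for i = N is empty. *)
transitivity (\sum_(i < N.+1) (\sum_(j < N - i) term x y i j + term x y i (N - i))).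
  rewrite big_split /= big_ord_recr /= subnn big_ord0 addr0; congr (_ + _).
  rewrite exprDn mulr_suml; apply: eq_bigr => -[i ltiN] _ /=.
  have leiN : (i <= N)%N by [].
  rewrite /term mulrACA -mulr_natr -(mulrA (_ * _)); congr (_ * _).
  have b0 : 'C(N, i)%:R != 0 :> K by rewrite pnatr_eq0 -lt0n bin_gt0.
  rewrite -invfM -natrM [in RHS]mulnC -(bin_fact leiN) natrM.
  by rewrite invfM mulrA mulfV // mul1r.
by apply: eq_bigr => -[i ltiN] _ /=; rewrite subSn // big_ord_recr.
Qed.

Lemma exp_sumM x y N :
  exp_sum x N * exp_sum y N = \sum_(i < N) \sum_(j < N) term x y i j.
Proof.
rewrite /exp_sum mulr_sumr; apply: eq_bigr => i _.
by rewrite mulr_suml; apply: eq_bigr.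
Qed.

(* The terms missing from the product of the partial sums are the same for the
   moduli, whose partial sums converge to the product. *)
Lemma exp_sum_err x y N :
  `|exp_sum x N * exp_sum y N - exp_sum (x + y) N| <=
  exp_sum `|x| N * exp_sum `|y| N - exp_sum (`|x| + `|y|) N.
Proof.
have err u v : exp_sum u N * exp_sum v N - exp_sum (u + v) N
    = \sum_(i < N) \sum_(N - i <= j < N) term u v i j.
  rewrite exp_sumM exp_sumD -sumrB; apply: eq_bigr => i _.
  rewrite -(big_mkord xpredT (term u v i)) -(big_mkord xpredT (term u v i)).
  rewrite [X in X - _](big_cat_nat (n := (N - i)%N)) ?leq_subr //=.
  by rewrite addrAC subrr add0r.
rewrite !err (le_trans (ler_norm_sum _ _ _)) // ler_sum // => i _.
rewrite (le_trans (ler_norm_sum _ _ _)) // ler_sum // => j _.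
by rewrite /term !normrM !normrX !normfV !normr_nat.
Qed.

End ExpSum.

Section ComplexExp.
Variable R : realType.
Local Notation C := R[i].

Lemma exp_sum_real (x : R) N : exp_sum x%:C N = (exp_sum x N)%:C.
Proof.
rewrite /exp_sum rmorph_sum; apply: eq_bigr => k _.
by rewrite rmorphM rmorphXn fmorphV rmorph_nat.
Qed.

Lemma exp_sum_cvg (x : R) : exp_sum x @ \oo --> expR x.
Proof.
have -> : exp_sum x = series (exp_coeff x).
  by apply/funext => N; rewrite /exp_sum /series /= big_mkord.
exact: is_cvg_series_exp_coeff.
Qed.

Lemma exp_sum_im (y : R) N : exp_sum ('i%C * y%:C) N =
  (series (cos_coeff y) N)%:C + 'i%C * (series (sin_coeff y) N)%:C.
Proof.
rewrite /exp_sum /series /= !big_mkord !rmorph_sum mulr_sumr -big_split /=.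
apply: eq_bigr => k _; move: (nat_of_ord k) => {}k.
(* The powers of i, written with the parity factors and signs of [cos_coeff] and [sin_coeff]. *)
have iE : ('i%C : C) ^+ k = ((~~ odd k)%:R * (-1) ^+ k./2)%:C
    + 'i%C * ((odd k)%:R * (-1) ^+ k.-1./2)%:C.
  rewrite -{1}(odd_double_half k) exprD -mul2n exprM sqr_i.
  rewrite !rmorphM !rmorphXn !rmorph_nat !rmorphN1.
  case: (boolP (odd k)) => ok;
    rewrite /= ?expr0 ?expr1 ?mul0r ?mulr0 ?mul1r ?add0r ?addr0; last by [].
  by case: k ok => //= k /negbTE ok; rewrite uphalf_half ok.
rewrite exprMn iE !rmorphM !fmorphV !rmorphXn !rmorph_nat.
by rewrite ?mulrDl ?mulrA.
Qed.

Lemma real_complex_cvg (u : nat -> R) (x : R) :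
  u @ \oo --> x -> (fun N => (u N)%:C : C^o) @ \oo --> (x%:C : C^o).
Proof.
move=> /cvgrPdist_lt ux; apply/cvgrPdist_lt => -[e e'] ; rewrite ltcE /=.
move=> /andP[/eqP -> e0]; near=> N.
have -> : (x%:C : C^o) - (u N)%:C = (x - u N)%:C by rewrite rmorphB.
rewrite normc_def /= expr0n addr0 sqrtr_sqr ltcR.
by near: N; exact: ux.
Unshelve. all: by end_near. Qed.

Lemma complex_squeeze (u : nat -> C^o) (v : nat -> R) :
  (forall N, `|u N| <= (v N)%:C) -> v @ \oo --> (0 : R) -> u @ \oo --> (0 : C^o).
Proof.
move=> uv /real_complex_cvg /cvgr0Pnorm_lt v0.
apply/cvgr0Pnorm_lt => e /v0; apply: filterS => N; apply: le_lt_trans.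
rewrite (le_trans (uv N)) // real_ler_norm //.
by apply/complex_realP; exists (v N).
Qed.

(** For z = a + b with a real and b imaginary, the product of the partial sums converges to [expC z]
    by the real series of exp, cos and sin. By [exp_sum_err] its distance to the partial sum at z is
    at most the same difference for |a| and |b|, which tends to 0 by [expRD]. *)
Lemma exp_sum_cvgC (z : C) : (exp_sum z : nat -> C^o) @ \oo --> (expC z : C^o).
Proof.
pose a : C := (complex.Re z)%:C; pose b : C := 'i%C * (complex.Im z)%:C.
have zE : z = a + b by exact: complexE.
have na : `|a| = `|complex.Re z|%:C.
  by rewrite normc_def /= expr0n addr0 sqrtr_sqr.
have nb : `|b| = `|complex.Im z|%:C.
  by rewrite normc_def /= !(mul0r, mul1r, add0r, oppr0) expr0n add0r sqrtr_sqr.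
have ab : (fun N => exp_sum a N * exp_sum b N : C^o) @ \oo --> (expC z : C^o).
  have -> : expC z = (expR (complex.Re z))%:C *
      ((cos (complex.Im z))%:C + 'i%C * (sin (complex.Im z))%:C) :> C.
    rewrite /expC; congr (_ * _).
    apply/eqP; rewrite eq_complex /=.
    by rewrite !(mul0r, mul1r, add0r, addr0, subr0, oppr0) !eqxx.
  apply: (@cvgM _ _ _ _ (exp_sum a : nat -> C^o) (exp_sum b : nat -> C^o)).
    rewrite (funext (exp_sum_real (complex.Re z))).
    exact/real_complex_cvg/exp_sum_cvg.
  rewrite (funext (exp_sum_im (complex.Im z))); apply: (@cvgD _ C^o).
    by apply: real_complex_cvg; rewrite unlock; exact: is_cvg_series_cos_coeff.
  apply: (@cvgM _ _ _ _ (cst ('i%C : C^o))); first exact: cvg_cst.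
  by apply: real_complex_cvg; rewrite unlock; exact: is_cvg_series_sin_coeff.
have err : (fun N => exp_sum a N * exp_sum b N - exp_sum z N : C^o) @ \oo --> (0 : C^o).
  apply: (@complex_squeeze _ (fun N =>
      exp_sum `|complex.Re z| N * exp_sum `|complex.Im z| N
      - exp_sum (`|complex.Re z| + `|complex.Im z|) N)).
    move=> N; rewrite {1}zE (le_trans (exp_sum_err _ _ _)) // na nb -rmorphD.
    by rewrite !exp_sum_real rmorphB rmorphM.
  rewrite -(subrr (expR (`|complex.Re z| + `|complex.Im z|))) {1}expRD.
  have hM := cvgM (@exp_sum_cvg `|complex.Re z|) (@exp_sum_cvg `|complex.Im z|).
  have hB := cvgB (hM _) (@exp_sum_cvg (`|complex.Re z| + `|complex.Im z|)).
  exact: hB _.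
have -> : (exp_sum z : nat -> C^o) = (fun N => exp_sum a N * exp_sum b N : C^o)
    - (fun N => exp_sum a N * exp_sum b N - exp_sum z N : C^o).
  by apply/funext => N; rewrite !fctE opprB addrCA subrr addr0.
by have := cvgB ab err _; rewrite subr0; apply.
Qed.

Lemma expCD (z w : C) : expC (z + w) = expC z * expC w.
Proof.
case: z w => [a b] [c d]; rewrite /expC /= expRD cosD sinD rmorphM.
rewrite mulrACA; congr (_ * _); apply/eqP; rewrite eq_complex /=; apply/andP.
by split; apply/eqP; rewrite // addrC.
Qed.

End ComplexExp.

(** * Laplace transforms of exponential polynomials *)

Section HalfLine.
Variable R : realType.
Local Notation mu := (@lebesgue_measure R).
Implicit Types f g F G : R -> R.

Lemma is_derive_continuous F f : (forall x : R, is_derive x 1 F (f x)) -> continuous F.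
Proof.
move=> dF x; have [dFx _] := dF x.
exact/differentiable_continuous/derivable1_diffP.
Qed.

Lemma ge0_FTC_halfline f F (l : R) :
  (forall x : R, 0 <= x -> 0 <= f x) -> continuous f ->
  (forall x : R, is_derive x 1 F (f x)) -> F x @[x --> +oo] --> l ->
  mu.-integrable `[0, +oo[ (EFin \o f) /\
  \int[mu]_(x in `[0, +oo[) f x = l - F 0.
Proof.
move=> f0 cf dF Fl.
have cF := is_derive_continuous dF.
have intE : (\int[mu]_(x in `[0%R, +oo[) (f x)%:E = l%:E - (F 0%R)%:E)%E.
  apply: (ge0_continuous_FTC2y f0 _ Fl).
  - exact: continuous_subspaceT.
  - by move=> x _; have [] := dF x.
  - by apply: cvg_at_right_filter; exact: cF.
  - by move=> x _; rewrite derive1E; have [_ ->] := dF x.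
split; last by rewrite /Rintegral intE.
apply/integrableP; split.
  by apply/measurable_EFinP; apply: measurable_funTS; exact: continuous_measurable_fun.
have -> : (\int[mu]_(x in `[0%R, +oo[) `|(EFin \o f) x|)%E
    = (\int[mu]_(x in `[0%R, +oo[) (f x)%:E)%E.
  apply: eq_integral => x; rewrite inE /= in_itv /= andbT => x0.
  by rewrite ger0_norm // f0.
by rewrite intE -EFinB ltry.
Qed.

Lemma FTC_halfline f F (l : R) g G (l' : R) :
  (forall x : R, 0 <= x -> `|f x| <= g x) -> continuous f -> continuous g ->
  (forall x : R, is_derive x 1 F (f x)) -> F x @[x --> +oo] --> l ->
  (forall x : R, is_derive x 1 G (g x)) -> G x @[x --> +oo] --> l' ->
  mu.-integrable `[0, +oo[ (EFin \o f) /\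
  \int[mu]_(x in `[0, +oo[) f x = l - F 0.
Proof.
move=> fg cf cg dF Fl dG Gl.
(* f is the difference of g + f and g, which are nonnegative. *)
have [ig Ig] : mu.-integrable `[0, +oo[ (EFin \o g) /\
    \int[mu]_(x in `[0, +oo[) g x = l' - G 0.
  apply: ge0_FTC_halfline => // x x0; exact: le_trans (fg _ x0).
have [ik Ik] : mu.-integrable `[0, +oo[ (EFin \o (g \+ f)) /\
    \int[mu]_(x in `[0, +oo[) (g \+ f) x = (l' + l) - (G \+ F) 0.
  have k0 x : 0 <= x -> 0 <= (g \+ f) x.
    by move=> /fg; rewrite ler_norml /= -subr_ge0 opprK addrC => /andP[].
  have ck : continuous (g \+ f) by move=> x; apply: cvgD; [exact: cg|exact: cf].
  have dK (x : R) : is_derive x 1 (G \+ F) ((g \+ f) x) by exact: is_deriveD.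
  apply: (ge0_FTC_halfline k0 ck dK).
  by apply: cvgD.
have fE : (EFin \o f = (EFin \o (g \+ f)%R) \- (EFin \o g))%E.
  by apply/funext => x /=; rewrite -EFinB addrAC subrr add0r.
split; first by rewrite fE; exact: integrableB.
have -> : \int[mu]_(x in `[0, +oo[) f x =
    \int[mu]_(x in `[0, +oo[) ((g \+ f) x - g x).
  by apply: eq_Rintegral => x _ /=; rewrite addrAC subrr add0r.
by rewrite RintegralB // Ik Ig /= !opprD !opprK; lra.
Qed.

Lemma cvg_expR_scale (c : R) : 0 < c -> expR (- (c * x)) @[x --> +oo] --> (0 : R).
Proof.
move=> c0; apply/cvgrPdist_le => e e0.
have /cvgrPdist_le /(_ e e0) [M [Mr h]] :=
  @cvgr_expR R.
exists (M / c); split; first exact: num_real.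
by move=> x; rewrite ltr_pdivrMr // mulrC => /h.
Qed.

Lemma pow_expR_bound (c : R) j : 0 < c ->
  exists2 K, 0 <= K & forall x, 0 <= x -> x ^+ j * expR (- (c * x)) <= K.
Proof.
(* The constant comes from exp(u) >= u^j / j! at u = c x. *)
move=> c0; exists (j`!%:R / c ^+ j) => [|x x0].
  by rewrite divr_ge0 // exprn_ge0 // ltW.
rewrite expRN ler_pdivrMr ?expR_gt0 // mulrAC ler_pdivlMr ?exprn_gt0 //.
rewrite -exprMn (mulrC x) -ler_pdivrMl ?ltr0n ?fact_gt0 // [X in X <= _]mulrC.
have cx : 0 <= c * x by rewrite mulr_ge0 // ltW.
case: j => [|j].
  by rewrite expr0 fact0 divr1 (le_trans _ (expR_ge1Dx _)) // lerDl.
by rewrite (le_trans _ (expR_ge1Dxn j cx)) // lerDr.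
Qed.

Lemma pow_expR_cvg0 (c : R) j : 0 < c ->
  x ^+ j * expR (- (c * x)) @[x --> +oo] --> (0 : R).
Proof.
(* Half of the exponential bounds the power of x, the other half tends to 0. *)
move=> c0; have c2 : 0 < c / 2 by rewrite divr_gt0.
have [K K0 hK] := pow_expR_bound j c2.
apply: (@squeeze_cvgr _ _ _ _ (fun=> 0) (fun x => K * expR (- (c / 2 * x)))).
- near=> x; have x0 : 0 <= x by near: x; apply: nbhs_pinfty_ge; exact: num_real.
  rewrite mulr_ge0 ?exprn_ge0 ?expR_ge0 //=.
  have -> : - (c * x) = - (c / 2 * x) + - (c / 2 * x) by lra.
  by rewrite expRD mulrA ler_wpM2r ?expR_ge0 // hK.
- exact: cvg_cst.
- rewrite -[X in _ --> X](mulr0 K); apply: cvgM; first exact: cvg_cst.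
  exact: cvg_expR_scale.
Unshelve. all: by end_near. Qed.

End HalfLine.

Section ComplexDerivative.
Variable R : realType.
Local Notation C := R[i].
Local Notation Re := (@complex.Re R).
Local Notation Im := (@complex.Im R).
Implicit Types (F G f g : R -> C) (c z : C).

Lemma ReD (a b : C) : Re (a + b) = Re a + Re b. Proof. by case: a b => ? ? []. Qed.
Lemma ImD (a b : C) : Im (a + b) = Im a + Im b. Proof. by case: a b => ? ? []. Qed.
Lemma ReM (a b : C) : Re (a * b) = Re a * Re b - Im a * Im b.
Proof. by case: a b => ? ? []. Qed.
Lemma ImM (a b : C) : Im (a * b) = Re a * Im b + Im a * Re b.
Proof. by case: a b => ? ? []. Qed.

Definition cderive F f := forall t : R,
  is_derive t 1 (Re \o F) (Re (f t)) /\ is_derive t 1 (Im \o F) (Im (f t)).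

Lemma cderive_ext F f f' : f =1 f' -> cderive F f -> cderive F f'.
Proof. by move=> ff' dF t; rewrite -ff'. Qed.

Lemma cderive_cst c : cderive (fun=> c) (fun=> 0).
Proof. by move=> t; split; exact: is_derive_cst. Qed.

Lemma cderive_real : cderive (fun t => t%:C) (fun=> 1).
Proof. by move=> t; split; [exact: is_derive_id|exact: is_derive_cst]. Qed.

Lemma cderiveD F f G g : cderive F f -> cderive G g ->
  cderive (fun t => F t + G t) (fun t => f t + g t).
Proof.
move=> dF dG t; have [rF iF] := dF t; have [rG iG] := dG t.
have -> : Re \o (fun t => F t + G t) = (Re \o F) + (Re \o G).
  by apply/funext => u /=; rewrite ReD.
have -> : Im \o (fun t => F t + G t) = (Im \o F) + (Im \o G).
  by apply/funext => u /=; rewrite ImD.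
by rewrite ReD ImD; split; exact: is_deriveD.
Qed.

Lemma cderiveM F f G g : cderive F f -> cderive G g ->
  cderive (fun t => F t * G t) (fun t => f t * G t + F t * g t).
Proof.
move=> dF dG t; have [rF iF] := dF t; have [rG iG] := dG t.
have -> : Re \o (fun t => F t * G t) = (Re \o F) * (Re \o G) - (Im \o F) * (Im \o G).
  by apply/funext => u /=; rewrite ReM.
have -> : Im \o (fun t => F t * G t) = (Re \o F) * (Im \o G) + (Im \o F) * (Re \o G).
  by apply/funext => u /=; rewrite ImM.
rewrite ReD ImD !ReM !ImM; split.
  have h3 := is_deriveB (is_deriveM rF rG) (is_deriveM iF iG). apply: (is_derive_eq h3).
  by rewrite /GRing.scale /=; ring.
have h3 := is_deriveD (is_deriveM rF iG) (is_deriveM iF rG); apply: (is_derive_eq h3).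
by rewrite /GRing.scale /=; ring.
Qed.

Lemma cderiveZ c F f : cderive F f -> cderive (fun t => c * F t) (fun t => c * f t).
Proof.
move=> dF; apply: (cderive_ext _ (cderiveM (cderive_cst c) dF)) => t.
by rewrite mul0r add0r.
Qed.

Lemma expC_real z (t : R) : expC (- (z * t%:C)) =
  (expR (- (Re z * t)) * cos (Im z * t)) +i* (- (expR (- (Re z * t)) * sin (Im z * t))).
Proof.
case: z => x y; rewrite /expC /= mulr0 mulr0 subr0 add0r cosN sinN.
by apply/eqP; rewrite eq_complex /= !mul0r addr0 subr0 mulrN !eqxx.
Qed.

Lemma cderive_expC z :
  cderive (fun t => expC (- (z * t%:C))) (fun t => - z * expC (- (z * t%:C))).
Proof.
have dl (k t : R) : is_derive t 1 (fun u => k * u) k.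
  by apply: is_derive_eq; rewrite /GRing.scale /= ?mulr1 ?mulr0 ?addr0.
move=> t; have -> : (fun u : R => expC (- (z * u%:C))) = fun u =>
    (expR (- (Re z * u)) * cos (Im z * u))
    +i* (- (expR (- (Re z * u)) * sin (Im z * u))).
  by apply/funext => u; rewrite expC_real.
rewrite expC_real.
have de : is_derive t 1 (fun u => expR (- (Re z * u))) (- Re z * expR (- (Re z * t))).
  have -> : (fun u => expR (- (Re z * u))) = expR \o (fun u => - Re z * u).
    by apply/funext => u /=; rewrite mulNr.
  have h := @is_derive1_comp _ expR _ _ _ _ (is_derive_expR _) (dl (- Re z) t).
  apply: (is_derive_eq h).
  by rewrite mulNr mulrC.
have dc : is_derive t 1 (fun u => cos (Im z * u)) (- sin (Im z * t) * Im z).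
  exact: (@is_derive1_comp _ _ _ _ _ _ (is_derive_cos _) (dl (Im z) t)).
have ds : is_derive t 1 (fun u => sin (Im z * u)) (cos (Im z * t) * Im z).
  exact: (@is_derive1_comp _ _ _ _ _ _ (is_derive_sin _) (dl (Im z) t)).
rewrite ReM ImM; split.
  have h := is_deriveM de dc; apply: (is_derive_eq h).
  by rewrite /GRing.scale /=; case: (z) => x y /=; ring.
have h := is_deriveN (is_deriveM de ds); apply: (is_derive_eq h).
by rewrite /GRing.scale /=; case: (z) => x y /=; ring.
Qed.

(** With z = s - lambda, the Laplace integrand at s of t^j exp(lambda t). *)
Definition pow_exp z j (t : R) : C := t%:C ^+ j * expC (- (z * t%:C)).

(** For j = 0 the truncated index [j.-1] is harmless, its factor being 0. *)
Lemma cderive_pow_exp z j : cderive (pow_exp z j)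
  (fun t => j%:R * pow_exp z j.-1 t - z * pow_exp z j t).
Proof.
elim: j => [|j IHj].
  have -> : pow_exp z 0 = fun t => expC (- (z * t%:C)).
    by apply/funext => t; rewrite /pow_exp expr0 mul1r.
  apply: (cderive_ext _ (cderive_expC z)) => t.
  by rewrite mul0r sub0r mulNr.
have -> : pow_exp z j.+1 = fun t => t%:C * pow_exp z j t.
  by apply/funext => t; rewrite /pow_exp exprS mulrA.
apply: (cderive_ext _ (cderiveM cderive_real IHj)) => t /=.
rewrite /pow_exp; case: j {IHj} => [|j] /=; rewrite -?natr1 ?exprS; ring.
Qed.

Definition ctends0 F :=
  (Re (F t) @[t --> +oo] --> (0 : R)) /\ (Im (F t) @[t --> +oo] --> (0 : R)).

Lemma ctends0D F G : ctends0 F -> ctends0 G -> ctends0 (fun t => F t + G t).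
Proof.
move=> [rF iF] [rG iG]; rewrite /ctends0.
have -> : (fun t => Re (F t + G t)) = (fun t => Re (F t)) \+ (fun t => Re (G t)).
  by apply/funext => t /=; rewrite ReD.
have -> : (fun t => Im (F t + G t)) = (fun t => Im (F t)) \+ (fun t => Im (G t)).
  by apply/funext => t /=; rewrite ImD.
split.
  by have := cvgD rF rG _; rewrite addr0; apply.
by have := cvgD iF iG _; rewrite addr0; apply.
Qed.

Lemma ctends0Z c F : ctends0 F -> ctends0 (fun t => c * F t).
Proof.
move=> [rF iF]; rewrite /ctends0.
have -> : (fun t => Re (c * F t)) =
    (Re c \*o (fun t => Re (F t))) \- (Im c \*o (fun t => Im (F t))).
  by apply/funext => t /=; rewrite ReM.
have -> : (fun t => Im (c * F t)) =
    (Re c \*o (fun t => Im (F t))) \+ (Im c \*o (fun t => Re (F t))).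
  by apply/funext => t /=; rewrite ImM.
have scale0 (k : R) (u : R -> R) :
    u t @[t --> +oo] --> (0 : R) -> k * u t @[t --> +oo] --> (0 : R).
  by move=> u0; have := cvgM (cvg_cst k) u0 _; rewrite mulr0; apply.
split.
  by have := cvgB (scale0 (Re c) _ rF) (scale0 (Im c) _ iF) _; rewrite subr0; apply.
by have := cvgD (scale0 (Re c) _ iF) (scale0 (Im c) _ rF) _; rewrite addr0; apply.
Qed.

Lemma pow_expE z j t : pow_exp z j t =
  (t ^+ j * expR (- (Re z * t)) * cos (Im z * t))
  +i* (- (t ^+ j * expR (- (Re z * t)) * sin (Im z * t))).
Proof.
rewrite /pow_exp expC_real -rmorphXn /=; apply/eqP; rewrite eq_complex /=.
by rewrite !mul0r addr0 subr0 mulrN !mulrA !eqxx.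
Qed.

Lemma ctends0_pow_exp z j : 0 < Re z -> ctends0 (pow_exp z j).
Proof.
move=> z0; have h := pow_expR_cvg0 j z0.
have sq (u v : R -> R) : (forall t, 0 <= t -> `|u t| <= v t) ->
    v t @[t --> +oo] --> (0 : R) -> u t @[t --> +oo] --> (0 : R).
  move=> uv v0; apply: (@squeeze_cvgr _ _ _ _ (\- v) v) => //; last first.
    by rewrite -[X in _ --> X]oppr0; exact: cvgN.
  near=> t; rewrite -ler_norml; apply: uv.
  by near: t; apply: nbhs_pinfty_ge; exact: num_real.
have g0 t : 0 <= t -> 0 <= t ^+ j * expR (- (Re z * t)).
  by move=> t0; rewrite mulr_ge0 ?exprn_ge0 ?expR_ge0.
split; apply: sq h => t t0; rewrite pow_expE /= ?normrN normrM ger0_norm ?g0 //.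
  by rewrite ler_piMr ?g0 // ler_norml cos_geN1 cos_le1.
by rewrite ler_piMr ?g0 // ler_norml sin_geN1 sin_le1.
Unshelve. all: by end_near. Qed.

(** Integration by parts, by induction on j. As the primitive vanishes at infinity, - H 0 is the
    integral over the half line. *)
Lemma pow_exp_primitive z j : 0 < Re z -> exists H, [/\ cderive H (pow_exp z j),
  ctends0 H & H 0 = - (j`!%:R * z^-1 ^+ j.+1)].
Proof.
move=> z0; have zn0 : z != 0 by apply: contraTneq z0 => ->; rewrite ltxx.
elim: j => [|j [H [dH tH H0]]].
  exists (fun t => - z^-1 * pow_exp z 0 t); split.
  - apply: (cderive_ext _ (cderiveZ _ (cderive_pow_exp z 0))) => t /=.
    by rewrite mul0r sub0r mulrNN mulKf.
  - exact/ctends0Z/ctends0_pow_exp.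
  - by rewrite /pow_exp rmorph0 !expr0 mulr0 oppr0 /expC /= expR0 cos0 sin0 expr1
      !mul1r mulr1.
exists (fun t => z^-1 * (-1 * pow_exp z j.+1 t + j.+1%:R * H t)); split.
- have d1 := cderiveZ (-1) (cderive_pow_exp z j.+1).
  apply: (cderive_ext _ (cderiveZ z^-1 (cderiveD d1 (cderiveZ j.+1%:R dH)))) => t.
  by rewrite /= mulN1r opprB addrNK mulKf.
- apply/ctends0Z/ctends0D; first exact/ctends0Z/ctends0_pow_exp.
  exact: ctends0Z.
- have -> : pow_exp z j.+1 0 = 0 by rewrite /pow_exp rmorph0 expr0n mul0r.
  rewrite H0 mulr0 add0r !mulrN factS natrM [z^-1 ^+ j.+2]exprS; congr (- _).
  by rewrite -!mulrA mulrCA; congr (_ * _); rewrite mulrCA.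
Qed.

End ComplexDerivative.

(** * Existence and uniqueness of inverse Laplace transforms *)

Section InverseLaplaceTheory.
Variable R : realType.
Local Notation C := R[i].
Local Notation ratfun := {fraction {poly C}}.
Local Notation Re := (@complex.Re R).
Local Notation Im := (@complex.Im R).
Local Notation mu := (@lebesgue_measure R).
Local Notation X := (tofrac 'X : ratfun).
Local Notation cst := (@ratcst R).
Implicit Types (f : C -> C) (g : ratfun) (a : nat -> C) (s lambda : C).

Lemma laplace_pow_exp lambda j s : Re lambda < Re s ->
  laplace_integrable (fun t => t ^+ j * expC (lambda * t)) s /\
  laplace (fun t => t ^+ j * expC (lambda * t)) s
    = j`!%:R * (s - lambda)^-1 ^+ j.+1.
Proof.
move=> ltls; set z := s - lambda.
have z0 : 0 < Re z by move: ltls; rewrite /z; case: (s) (lambda) => ? ? [? ?] /=; lra.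
have E : laplace_integrand (fun t => t ^+ j * expC (lambda * t)) s = pow_exp z j.
  apply/funext => t; rewrite /laplace_integrand /pow_exp mulrCA -expCD.
  by congr (_ * expC _); rewrite /z; ring.
have [H [dH [rH iH] H0]] := pow_exp_primitive j z0.
(* The dominating function t^j exp(- Re z t) is itself [pow_exp] at the real number Re z, so its
   primitive G comes from the same lemma. *)
have x0 : 0 < Re (Re z)%:C by [].
have [G [dG [rG _] _]] := pow_exp_primitive j x0.
have gE t : (Re \o pow_exp (Re z)%:C j) t = t ^+ j * expR (- (Re z * t)).
  by rewrite /= pow_expE /= mul0r cos0 mulr1.
have g0 t : 0 <= t -> 0 <= t ^+ j * expR (- (Re z * t)).
  by move=> t0; rewrite mulr_ge0 ?exprn_ge0 ?expR_ge0.
have cr w : continuous (Re \o pow_exp w j).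
  exact: is_derive_continuous (fun t => (cderive_pow_exp w j t).1).
have ci w : continuous (Im \o pow_exp w j).
  exact: is_derive_continuous (fun t => (cderive_pow_exp w j t).2).
have [] := @FTC_halfline R (Re \o pow_exp z j) (Re \o H) 0 (Re \o pow_exp (Re z)%:C j)
  (Re \o G) 0 _ (cr _) (cr _) (fun t => (dH t).1) rH (fun t => (dG t).1) rG.
  move=> t t0; rewrite gE /= pow_expE /= normrM ger0_norm ?g0 //.
  by rewrite ler_piMr ?g0 // ler_norml cos_geN1 cos_le1.
move=> i1 I1.
have [] := @FTC_halfline R (Im \o pow_exp z j) (Im \o H) 0 (Re \o pow_exp (Re z)%:C j)
  (Re \o G) 0 _ (ci _) (cr _) (fun t => (dH t).2) iH (fun t => (dG t).1) rG.
  move=> t t0; rewrite gE /= pow_expE /= normrN normrM ger0_norm ?g0 //.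
  by rewrite ler_piMr ?g0 // ler_norml sin_geN1 sin_le1.
move=> i2 I2; rewrite /laplace_integrable /laplace E; split; first by split.
rewrite I1 I2 /= H0; case: (_ * _) => p q /=.
by rewrite !sub0r !opprK.
Qed.

Lemma halfline_integrableD (u v : R -> R) :
  mu.-integrable `[0, +oo[ (EFin \o u) -> mu.-integrable `[0, +oo[ (EFin \o v) ->
  mu.-integrable `[0, +oo[ (EFin \o (fun t => u t + v t)).
Proof.
move=> iu iv; have -> : (EFin \o (fun t => u t + v t)%R =
  (EFin \o u) \+ (EFin \o v))%E by [].
exact: integrableD.
Qed.

Lemma halfline_integrableZ (k : R) (u : R -> R) :
  mu.-integrable `[0, +oo[ (EFin \o u) ->
  mu.-integrable `[0, +oo[ (EFin \o (fun t => k * u t)).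
Proof.
move=> iu; have -> : (EFin \o (fun t => k * u t)%R =
  (fun t => k%:E * (EFin \o u) t))%E by [].
exact: integrableZl.
Qed.

Lemma laplaceD f1 f2 s : laplace_integrable f1 s -> laplace_integrable f2 s ->
  laplace_integrable (fun t => f1 t + f2 t) s /\
  laplace (fun t => f1 t + f2 t) s = laplace f1 s + laplace f2 s.
Proof.
move=> [r1 i1] [r2 i2]; rewrite /laplace_integrable /laplace.
have -> : (fun t => Re (laplace_integrand (fun t => f1 t + f2 t) s t)) =
    (fun t => Re (laplace_integrand f1 s t) + Re (laplace_integrand f2 s t)).
  by apply/funext => t; rewrite /laplace_integrand mulrDr ReD.
have -> : (fun t => Im (laplace_integrand (fun t => f1 t + f2 t) s t)) =
    (fun t => Im (laplace_integrand f1 s t) + Im (laplace_integrand f2 s t)).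
  by apply/funext => t; rewrite /laplace_integrand mulrDr ImD.
by rewrite !RintegralD //; split=> //; split; exact: halfline_integrableD.
Qed.

Lemma laplaceZ c f s : laplace_integrable f s ->
  laplace_integrable (fun t => c * f t) s /\
  laplace (fun t => c * f t) s = c * laplace f s.
Proof.
move=> [r i]; rewrite /laplace_integrable /laplace.
have -> : (fun t => Re (laplace_integrand (fun t => c * f t) s t)) = (fun t =>
    Re c * Re (laplace_integrand f s t) + - Im c * Im (laplace_integrand f s t)).
  by apply/funext => t; rewrite /laplace_integrand mulrCA (ReM c) mulNr.
have -> : (fun t => Im (laplace_integrand (fun t => c * f t) s t)) = (fun t =>
    Re c * Im (laplace_integrand f s t) + Im c * Re (laplace_integrand f s t)).
  by apply/funext => t; rewrite /laplace_integrand mulrCA (ImM c).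
split; first by split; apply: halfline_integrableD; exact: halfline_integrableZ.
rewrite !RintegralD ?RintegralZl //; try exact: halfline_integrableZ.
by case: (c) => x y; rewrite mulNr.
Qed.

Lemma exp_polynomial0 : exp_polynomial (fun _ : C => 0).
Proof. by exists [::] => t; rewrite big_nil. Qed.

Lemma exp_polynomialD f1 f2 : exp_polynomial f1 -> exp_polynomial f2 ->
  exp_polynomial (fun t => f1 t + f2 t).
Proof.
by move=> [r1 h1] [r2 h2]; exists (r1 ++ r2) => t; rewrite big_cat h1 h2.
Qed.

Lemma exp_polynomialZ c f : exp_polynomial f -> exp_polynomial (fun t => c * f t).
Proof.
move=> [r h]; exists [seq (c *: u.1, u.2) | u <- r] => t.
rewrite h mulr_sumr big_map; apply: eq_bigr => u _ /=.
by rewrite hornerZ mulrA.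
Qed.

Lemma exp_polynomial_pow_exp lambda j :
  exp_polynomial (fun t : C => t ^+ j * expC (lambda * t)).
Proof. by exists [:: ('X^j, lambda)] => t; rewrite big_seq1 /= hornerXn. Qed.

Definition egf a (t : C) N : C^o := \sum_(k < N) a k * (t ^+ k / k`!%:R).

(** Linear in the three arguments together. The expansion makes [g] determine [a], and the
    convergent series makes [a] determine [f]. *)
Definition laplace_triple g f a :=
  [/\ exp_polynomial f,
      large_Re (fun s => laplace_integrable f s /\ laplace f s = ratfun_eval g s),
      forall t, egf a t @ \oo --> (f t : C^o) & expansion g a].

Lemma laplace_triple0 : laplace_triple 0 (fun=> 0) (fun=> 0).
Proof.
split.
- exact: exp_polynomial0.
- have [x h0] := ratfun_eval0 R.
  have [] : large_Re (fun s => laplace_integrable (fun=> 0) s /\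
      laplace (fun=> 0) s = 0).
    exists 0 => s s0; have [i _] := @laplace_pow_exp 0 0 s s0.
    have := laplaceZ 0 i; under eq_fun do rewrite mul0r.
    by rewrite mul0r.
  move=> x' h; exists (Num.max x x') => s; rewrite gt_max => /andP[/h0 -> /h].
  by [].
- move=> t; rewrite (_ : egf _ _ = (fun=> 0)); last first.
    by apply/funext => N; rewrite /egf big1 // => k _; rewrite mul0r.
  exact: cvg_cst.
- exact: expansion0.
Qed.

Lemma laplace_tripleD g1 f1 a1 g2 f2 a2 :
  laplace_triple g1 f1 a1 -> laplace_triple g2 f2 a2 ->
  laplace_triple (g1 + g2) (fun t => f1 t + f2 t) (fun k => a1 k + a2 k).
Proof.
move=> [p1 l1 c1 e1] [p2 l2 c2 e2]; split.
- exact: exp_polynomialD.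
- apply: large_Re_imp (large_Re_and (large_Re_and l1 l2) (ratfun_evalD g1 g2)).
  by move=> s [[[i1 <-] [i2 <-]] ->]; exact: laplaceD.
- move=> t; have -> : egf (fun k => a1 k + a2 k) t = egf a1 t + egf a2 t.
    apply/funext => N; rewrite /egf !fctE -big_split /=.
    by apply: eq_bigr => k _; exact: mulrDl.
  exact: cvgD.
- exact: expansionD.
Qed.

Lemma laplace_tripleZ c g f a : laplace_triple g f a ->
  laplace_triple (cst c * g) (fun t => c * f t) (fun k => c * a k).
Proof.
move=> [p l cv e]; split.
- exact: exp_polynomialZ.
- apply: large_Re_imp (large_Re_and l (ratfun_evalZ c g)) => s [[i <-] ->].
  exact: laplaceZ.
- move=> t; have -> : egf (fun k => c * a k) t = fun N => c * egf a t N.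
    apply/funext => N; rewrite /egf mulr_sumr.
    by apply: eq_bigr => k _; rewrite -mulrA.
  exact: (cvgM (cvg_cst (c : C^o)) (cv t)).
- exact: expansionZ.
Qed.

(** The terms below j vanish with the binomial coefficient; after the shift by j, C(N + j, j) / (N +
    j)! = 1 / (j! N!) leaves an exponential sum. *)
Lemma egf_pole lambda j t N :
  egf (fun k => 'C(k, j)%:R * lambda ^+ (k - j)) t (N + j)
  = j`!%:R^-1 * (t ^+ j * exp_sum (lambda * t) N).
Proof.
rewrite /egf; elim: N => [|N IHN].
  rewrite add0n /exp_sum big_ord0 !mulr0 big1 // => -[k ltkj] _ /=.
  by rewrite bin_small // !mul0r.
rewrite addSn big_ord_recr IHN /= /exp_sum big_ord_recr !mulrDr; congr (_ + _).
rewrite addnK -(bin_fact (leq_addl N j)) addnK exprMn exprD !natrM.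
have b0 : 'C(N + j, j)%:R != 0 :> C by rewrite pnatr_eq0 -lt0n bin_gt0 leq_addl.
have f0 k : k`!%:R != 0 :> C by rewrite pnatr_eq0 -lt0n fact_gt0.
move: (lambda ^+ N) (t ^+ N) (t ^+ j) => x y w.
by field; rewrite !f0 b0.
Qed.

(** A geometric series for j = 0; afterwards Pascal's rule is the recurrence of [expansion_div]. *)
Lemma expansion_pole lambda j :
  expansion (pole lambda j) (fun k => 'C(k, j)%:R * lambda ^+ (k - j)).
Proof.
elim: j => [|j IHj].
  have pr : proper (pole lambda 0).
    by have := proper_div 1 lambda (proper0 R); rewrite add0r rmorph1 mul1r -pole0.
  move=> k; set a := fun _ => _.
  suff -> : expansion_rem (pole lambda 0) a k = cst (lambda ^+ k) * pole lambda 0.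
    exact: properZ.
  elim: k => [|k IHk]; first by rewrite expr0 rmorph1 mul1r.
  have h : cst lambda = X - tofrac ('X - lambda%:P).
    by rewrite tofracB opprB addrCA subrr addr0.
  have cM : cst (lambda ^+ k.+1) = cst (lambda ^+ k) * cst lambda.
    by rewrite exprSr; exact: rmorphM.
  rewrite [LHS]/= IHk /a bin0 mul1r subn0 cM h mulrCA -mulrA mulrBl mulrBr.
  by rewrite pole0 mulfV ?tofrac_XsubC_neq0 // mulr1.
rewrite poleS; apply: (expansion_div _ _ IHj) => [|k].
  by rewrite bin0n mul0r.
rewrite binS natrD mulrDl subSS; congr (_ + _).
(* For k <= j the subtraction in the exponent is truncated, but the binomial coefficient is 0. *)
case: (ltnP j k) => jk; last by rewrite bin_small // mul0r mul0r mulr0.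
by rewrite mulrCA -exprS subnSK.
Qed.

Lemma laplace_triple_pole lambda j : laplace_triple (pole lambda j)
  (fun t => j`!%:R^-1 * (t ^+ j * expC (lambda * t)))
  (fun k => 'C(k, j)%:R * lambda ^+ (k - j)).
Proof.
split.
- exact/exp_polynomialZ/exp_polynomial_pow_exp.
- have ev : large_Re (fun s => Re lambda < Re s) by exists (Re lambda).
  apply: large_Re_imp (large_Re_and ev (ratfun_eval_pole lambda j)) => s [ls ->].
  have [i e] := laplace_pow_exp j ls.
  have [i' ->] := laplaceZ j`!%:R^-1 i; split=> //.
  by rewrite e mulKf // pnatr_eq0 -lt0n fact_gt0.
- move=> t; rewrite -(cvg_shiftn j).
  rewrite (funext (egf_pole lambda j t)).
  have h := cvgM (cvg_cst (t ^+ j : C^o)) (@exp_sum_cvgC R (lambda * t)) _.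
  exact: (cvgM (cvg_cst (j`!%:R^-1 : C^o)) (h _ _)).
- exact: expansion_pole.
Qed.

Lemma pfrac_triple g : partial_fraction g -> exists f a, laplace_triple g f a.
Proof.
elim=> [|c lambda j h _ [f [a T]]]; first by do 2!eexists; exact: laplace_triple0.
do 2!eexists; apply: (laplace_tripleD _ T); apply: laplace_tripleZ.
exact: laplace_triple_pole.
Qed.

(** Serves uniqueness: any candidate for an inverse transform is the transform of some fraction and
    has a power series. *)
Lemma exp_polynomial_triple f : exp_polynomial f ->
  exists g a, laplace_triple g f a.
Proof.
pose Q f := exists g a, laplace_triple g f a.
have Q0 : Q (fun=> 0) by do 2!eexists; exact: laplace_triple0.
have QD f1 f2 : Q f1 -> Q f2 -> Q (fun t => f1 t + f2 t).
  move=> [g1 [a1 T1]] [g2 [a2 T2]].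
  by do 2!eexists; exact: laplace_tripleD T1 T2.
have Qsum I (r : seq I) (F : I -> C -> C) :
    (forall x, Q (F x)) -> Q (fun t => \sum_(x <- r) F x t).
  move=> QF; elim: r => [|x r IHr].
    by rewrite (_ : (fun _ => _) = fun=> 0) //; apply/funext => t; rewrite big_nil.
  have -> : (fun t => \sum_(y <- x :: r) F y t) =
      (fun t => F x t + \sum_(y <- r) F y t).
    by apply/funext => t; rewrite big_cons.
  exact: (QD _ _ (QF x) IHr).
move=> [r fE]; rewrite (funext fE); apply: (Qsum) => -[p lambda] /=.
have -> : (fun t => p.[t] * expC (lambda * t)) =
    (fun t => \sum_(k < size p) p`_k * t ^+ k * expC (lambda * t)).
  by apply/funext => t; rewrite horner_coef mulr_suml.
apply: (Qsum _ _ (fun (k : 'I_(size p)) t => p`_k * t ^+ k * expC (lambda * t))) => k.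
(* The factor k! matches the normalization in [laplace_triple_pole]. *)
have -> : (fun t => p`_k * t ^+ k * expC (lambda * t)) =
  fun t => (p`_k * k`!%:R) * (k`!%:R^-1 * (t ^+ k * expC (lambda * t))).
  apply/funext => t; by rewrite [RHS]mulrA mulfK ?mulrA // pnatr_eq0 -lt0n fact_gt0.
by do 2!eexists; apply: laplace_tripleZ; exact: laplace_triple_pole.
Qed.

(** Each candidate lies in a triple whose fraction is [g] by [ratfun_eval_inj]. Both then have the
    same expansion, hence the same power series. *)
Lemma is_inv_laplace_uniq g f1 f2 :
  is_inv_laplace g f1 -> is_inv_laplace g f2 -> f1 = f2.
Proof.
have get f : is_inv_laplace g f -> exists a, laplace_triple g f a.
  move=> [/exp_polynomial_triple [g' [a T]] lg]; exists a.
  suff <- : g' = g by [].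
  have [_ lg' _ _] := T; apply: ratfun_eval_inj.
  by apply: large_Re_imp (large_Re_and lg lg') => s [[_ <-] [_ <-]].
move=> /get[a1 [_ _ c1 e1]] /get[a2 [_ _ c2 e2]].
have a12 : a1 = a2 by apply/funext; exact: expansion_uniq e1 e2.
apply/funext => t; move: (c1 t); rewrite a12 => /cvg_lim <- //.
by move/cvg_lim: (c2 t) => <-.
Qed.

Lemma inv_laplaceE g f : is_inv_laplace g f -> inv_laplace g = f.
Proof.
move=> gf; apply: (@is_inv_laplace_uniq g) => //.
exact: (@xgetPex _ (fun=> 0) [set f | is_inv_laplace g f] (ex_intro _ f gf)).
Qed.

End InverseLaplaceTheory.

(** * Entries of the matrix exponential as inverse Laplace transforms *)

Lemma blockE (D n : nat) (V : 'I_n -> {set 'I_D}) (A : pzSemiRingType)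
    (M : 'M[A]_D) (mu nu : 'I_n) i j :
  block V M mu nu i j = M (enum_val i) (enum_val j).
Proof.
rewrite /block mxE (bigD1 (enum_val j)) //= big1 => [|k ne]; last first.
  by rewrite !mxE eq_sym (negbTE ne) mulr0.
rewrite addr0 !mxE eqxx mulr1 (bigD1 (enum_val i)) //= big1 => [|k ne].
  by rewrite addr0 !mxE eqxx mul1r.
by rewrite !mxE eq_sym (negbTE ne) mul0r.
Qed.

Lemma expmx_egf (R : realType) (D : nat) (M : 'M[R[i]]_D) (tau : R[i]) i j :
  expmx (tau *: M) i j = limn (egf (fun k => (M ^+ k) i j) tau).
Proof.
rewrite mxE; apply: (congr1 (fun u : nat -> R[i]^o => limn u)); apply/funext => N.
rewrite summxE; apply: eq_bigr => k _.
have -> : (tau *: M) ^+ k = tau ^+ k *: M ^+ k.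
  elim: (nat_of_ord k) => [|m IHm]; first by rewrite !expr0 scale1r.
  by rewrite !exprS IHm -!mulmxE -scalemxAl -scalemxAr scalerA.
by rewrite !mxE [LHS]mulrC [RHS]mulrA; congr (_ * _); exact: mulrC.
Qed.

(** Invertibility of [Finv] and existence of the inverse transforms are asserted as well, so that
    neither [invmx] nor [inv_laplace] takes its default value in the formula. *)
Theorem theorem3p3 (R : realType) (D n : nat) (V : 'I_n -> {set 'I_D})
    (M : 'M[R[i]]_D) (hV : is_partition V) :
  (forall (S : {set 'I_n}) (alpha : 'I_n), alpha \in S ->
     Finv M (Fmx V M) S alpha \in unitmx) /\
  forall (tau : R[i]) (alpha omega : 'I_n),
    let Phi := path_sum M (Fmx V M) [set: 'I_n]%SET alpha omega in
    (forall i j, exists f : R[i] -> R[i], is_inv_laplace (Phi i j) f) /\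
    block V (expmx (tau *: M)) omega alpha
      = map_mx (fun g => inv_laplace g tau) Phi.
Proof.
split=> [S alpha aS|tau alpha omega Phi]; first exact: (Fmx_subres M hV aS).1.
have PhiE i j : Phi i j = resolvent M (enum_val i) (enum_val j).
  by rewrite /Phi (path_sum_resolvent M hV) blockE.
have key a b : exists2 f, is_inv_laplace (resolvent M a b) f &
    forall t, egf (fun k => (M ^+ k) a b) t @ \oo --> (f t : R[i]^o).
  have [f [c [p l cv e]]] := pfrac_triple (resolvent_pfrac M a b).
  exists f; first by split.
  suff -> : (fun k => (M ^+ k) a b) = c by [].
  (* The coefficients c found from the partial fractions must be the entries of the powers of M,
     both being expansions of the same fraction. *)
  apply/funext; apply: expansion_uniq e; apply: resolvent_expansion => k.
  (* The remainder of order 0 is the fraction itself, so having an expansion includes being strictly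
     proper. *)
  by have [? [? [_ _ _ /(_ 0%N)]]] := pfrac_triple (resolvent_pfrac M k b).
split=> [i j|].
  by rewrite PhiE; have [f hf _] := key (enum_val i) (enum_val j); exists f.
apply/matrixP => i j; rewrite blockE expmx_egf [RHS]mxE PhiE.
have [f hf cv] := key (enum_val i) (enum_val j).
by rewrite (inv_laplaceE hf); move/cvg_lim: (cv tau) => ->.
Qed.
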